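(* Let $n\ge2$, $1\le k\le n-1$, $\alpha_1,\alpha_2\in\mathbb{R}$ with $\alpha_2>0$, and $p=1+\alpha_2$. For $\gamma_1,\gamma_2\in\mathbb{R}$ consider $$\|\sin^{\gamma_1}d(0,\cdot)\cos^{\gamma_2}d(0,\cdot)\,R_kf\|_{L^\infty(\Xi_k(\mathbb{S}^n))}\le C\|f\|_{L^{p,1}_{\alpha_1,\alpha_2}(\mathbb{S}^n)}\quad\text{for all even radial }f\in L^{p,1}_{\alpha_1,\alpha_2}(\mathbb{S}^n).\qquad( * )$$ (A) If $k\ge2$, $( * )$ holds if and only if $\gamma_1\ge\max\{0,\frac{\alpha_1+n}{p}-k\}$ and $\gamma_2\ge1$. (B) If $k=1$, $( * )$ holds if and only if these conditions hold and $p\ge2$.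
   Context: $\mathbb{S}^n\subset\mathbb{R}^{n+1}$ unit sphere with origin $0:=e_{n+1}$, distance $d$, surface measure $dx$. $\Xi_k(\mathbb{S}^n)$: $k$-dimensional totally geodesic submanifolds (intersections with $(k+1)$-dimensional linear subspaces) with $d(0,\xi)<\pi/2$, with rotation-invariant measure ($L^\infty$ = essential supremum). $R_kf(\xi)=\int_\xi f\,d_\xi x$. $L^{p,1}_{\alpha_1,\alpha_2}(\mathbb{S}^n)$ is the Lorentz space $L^{p,1}(\mathbb{S}^n,\mu)$ for $d\mu=\sin^{\alpha_1}d(0,x)|\cos d(0,x)|^{\alpha_2}dx$, with norm $p\int_0^\infty\mu(\{|f|>s\})^{1/p}ds$. Even radial: $f(x)=F(|x_{n+1}|)$. $C$ independent of $f$. *)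

(* Defs.v *)
From HB Require Import structures.
From mathcomp Require Import all_boot all_order all_algebra.
From mathcomp Require Import all_classical all_reals all_analysis.
Set Implicit Arguments. Unset Strict Implicit. Unset Printing Implicit Defensive.
Import Order.TTheory GRing.Theory Num.Theory.
Local Open Scope classical_set_scope.
Local Open Scope ring_scope.

Section defs.
Variable R : realType.

Fixpoint lebI (m : nat) : (m.-tuple R -> \bar R) -> \bar R :=
  match m return (m.-tuple R -> \bar R) -> \bar R with
  | 0 => fun g => g [tuple]
  | m'.+1 => fun g =>
      (\int[@lebesgue_measure R]_x lebI (fun t => g (cons_tuple x t)))%E
  end.

Definition rv_of_tuple m (t : m.-tuple R) : 'rV[R]_m := \row_i tnth t i.

Definition leb_null m (B : set (m.-tuple R)) : Prop :=
  exists N : set (m.-tuple R),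
    measurable N /\ B `<=` N /\ lebI (fun t => (\1_N t)%:E) = 0%E.

Definition intRn m (g : 'rV[R]_m -> \bar R) : \bar R := lebI (g \o @rv_of_tuple m).

Definition dotv m (x y : 'rV[R]_m) : R := \sum_i x 0 i * y 0 i.
Definition enorm m (x : 'rV[R]_m) : R := Num.sqrt (dotv x x).

(** the origin 0 := e_{n+1} of S^n ⊂ R^{n+1} (last coordinate) *)
Definition npole n : 'rV[R]_n.+1 := \row_(i < n.+1) (i == ord_max)%:R.

Definition sdist m (x y : 'rV[R]_m) : R := acos (dotv x y).

(** surface integral over the unit sphere S^{m-1} ⊂ R^m (cone formula):
    ∫_{S^{m-1}} h dσ = m ∫_{0<|x|≤1} h(x/|x|) dx *)
Definition sphInt m (h : 'rV[R]_m -> \bar R) : \bar R :=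
  ((m%:R)%:E * intRn (fun x : 'rV[R]_m =>
      if ((0 < enorm x) && (enorm x <= 1))%R then h ((enorm x)^-1 *: x) else 0%E))%E.

Definition wS n (a1 a2 : R) (x : 'rV[R]_n.+1) : R :=
  (sin (sdist x (npole n))) `^ a1 * `|cos (sdist x (npole n))| `^ a2.

Definition muS n (a1 a2 : R) (E : set 'rV[R]_n.+1) : \bar R :=
  sphInt (fun x => ((\1_E x) * wS a1 a2 x)%:E).

Definition lorentz_norm n (a1 a2 p : R) (f : 'rV[R]_n.+1 -> R) : \bar R :=
  (p%:E * \int[@lebesgue_measure R]_(s in `[0%R, +oo[)
            (muS a1 a2 [set x | (s < `|f x|)%R]) `^ p^-1)%E.

Definition evenrad n (F : R -> R) (x : 'rV[R]_n.+1) : R := F `|x 0 ord_max|.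

(** the k-dimensional totally geodesic submanifold ξ_A = S^n ∩ rowspace(A) *)
Definition xi k n (A : 'M[R]_(k.+1, n.+1)) : set 'rV[R]_n.+1 :=
  [set x | enorm x = 1 /\ exists y : 'rV[R]_k.+1, x = y *m A].

Definition dist0 k n (A : 'M[R]_(k.+1, n.+1)) : R :=
  inf [set sdist x (npole n) | x in xi A].

Definition inXi k n (A : 'M[R]_(k.+1, n.+1)) : Prop :=
  row_free A /\ dist0 A < pi / 2.

(** k-plane transform: ∫_{ξ_A} f dx, via the linear parametrisation y ↦ yA
    of span(ξ_A) (Jacobian sqrt(det(A A^T))) and the cone formula *)
Definition Rk k n (A : 'M[R]_(k.+1, n.+1)) (f : 'rV[R]_n.+1 -> R) : \bar R :=
  ((k.+1%:R * Num.sqrt (\det (A *m A^T)))%R%:E *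
    intRn (fun y : 'rV[R]_k.+1 =>
      let x := y *m A in
      if ((0 < enorm x) && (enorm x <= 1))%R then (f ((enorm x)^-1 *: x))%:E
      else 0%E))%E.

Definition ae_mx m1 m2 (P : 'M[R]_(m1, m2) -> Prop) : Prop :=
  leb_null [set t : (m1 * m2).-tuple R | ~ P (vec_mx (rv_of_tuple t))].

Definition estimate (n k : nat) (a1 a2 g1 g2 : R) : Prop :=
  exists C : R, forall F : R -> R, measurable_fun (`[0%R, 1%R] : set R) F ->
    (lorentz_norm a1 a2 (1 + a2) (@evenrad n F) < +oo)%E ->
    ae_mx (fun A : 'M[R]_(k.+1, n.+1) => inXi A ->
      (`| ((sin (dist0 A)) `^ g1 * (cos (dist0 A)) `^ g2)%:E * Rk A (@evenrad n F) |
        <= C%:E * lorentz_norm a1 a2 (1 + a2) (@evenrad n F))%E).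
End defs.

(* Main.v *)
Require Import Defs.
From HB Require Import structures.
From mathcomp Require Import all_boot all_order all_algebra.
From mathcomp Require Import all_classical all_reals all_analysis.
From mathcomp Require Import measurable_realfun ring lra.
Set Implicit Arguments. Unset Strict Implicit. Unset Printing Implicit Defensive.
Import Order.TTheory GRing.Theory Num.Theory numFieldNormedType.Exports.
Local Open Scope classical_set_scope.
Local Open Scope ring_scope.

(** Gram--Schmidt and rotation invariance of Lebesgue measure reduce everything
    to dimension one.  If [c] is the largest last coordinate of a unit vector of
    the plane [A], so that [dist0 A = acos c], then for [f x = F `|x_{n+1}|]
    the transform [Rk A f] is a constant times
      [\int F (c |x|) (1 - x^2)^(k/2-1) dx],
    and [muS] has the one-dimensional density [(1 - x^2)^((a1+n)/2-1) |x|^a2].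

    Sufficiency: the Lorentz norm with second index 1 allows one to replace [F]
    by indicators of level sets, and for these the bound is a restricted
    inequality [L <= M y + y^(1-p) H], valid for every [y > 0], optimised in [y].

    Necessity: test with indicators of intervals [[a, b]].  The estimate holds
    only for almost every matrix, but the matrices whose [c] lies in a given
    interval contain a box, hence are not negligible.  Shrinking the intervals
    at [0] gives [1 <= g2], at [1] the two conditions on [g1], and at an
    interior point (where the singularity of [(1 - x^2)^(-1/2)] matters)
    [p >= 2] when [k = 1]. *)

(** The one-dimensional problem is governed by [(1 - x^2)^(k/2) |x|]. Against the density
    [(1 - x^2)^(k/2-1)] of the transform, the set where this function is below [y] has mass [O(y)]:
    near [0] it behaves like [|x|] and the density like a constant, and near [1] integrating the
    density gives back [(1 - x)^(k/2)]. The [(p-1)]-th power of the function times the density is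
    what survives, uniformly in [c], of the density of [muS] after substituting [c x]. This holds
    because [1 - c^2 x^2] is at most [1] and dominates both [1 - c^2] and [1 - x^2]. The comparison
    needs the exponent [p k/2 - 1] to be nonnegative, which is automatic for [k >= 2] and means
    [p >= 2] for [k = 1]. With [p = 1 + a2] the substitution produces [c^p], hence one factor [c]
    after taking the root; this makes [g2 = 1] the critical exponent.

    Volumes are never evaluated: homogeneity gives each formula up to a positive finite constant,
    and the theorem only needs that. *)

(** * Integration on the line: monotonicity, affine substitution, products *)

Section integral_monotone.
Local Open Scope ereal_scope.
Context d (T : measurableType d) (R : realType) (m : {measure set T -> \bar R}).
Implicit Types f g : T -> \bar R.

Import HBNNSimple.

(* Unlike [ge0_le_integral], this needs no measurability, since the integral of
   a nonnegative function is a supremum over the simple functions below it. *)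
Lemma le_integral_ge0 f g : (forall x, 0 <= f x) -> (forall x, f x <= g x) ->
  \int[m]_x f x <= \int[m]_x g x.
Proof.
move=> f0 fg; have g0 x : 0 <= g x by exact: le_trans (f0 x) (fg x).
rewrite !ge0_integralTE//; apply: ereal_sup_le => _ [h hf <-].
by exists h => // x; exact: le_trans (hf x) (fg x).
Qed.

(** Monotonicity applies to the positive and negative parts separately; if either integral is
    infinite, so is the right side. *)
Lemma abse_integral_le f : `|\int[m]_x f x| <= \int[m]_x `|f x|.
Proof.
rewrite integralE.
have p0 : 0 <= \int[m]_x (f^\+ x) by apply: integral_ge0.
have n0 : 0 <= \int[m]_x (f^\- x) by apply: integral_ge0.
have pa : \int[m]_x (f^\+ x) <= \int[m]_x `|f x|.
  apply: le_integral_ge0 => // x.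
  by rewrite -/((abse \o f) x) fune_abse leeDl.
have na : \int[m]_x (f^\- x) <= \int[m]_x `|f x|.
  apply: le_integral_ge0 => // x.
  by rewrite -/((abse \o f) x) fune_abse leeDr.
move: p0 n0 pa na.
move: (\int[m]_x (f^\+ x)) (\int[m]_x (f^\- x)) (\int[m]_x `|f x|).
move=> [p| |] [q| |] [r| |] //=; rewrite ?lee_fin ?leey// => *.
rewrite ler_norml; lra.
Qed.

End integral_monotone.

Section lebesgue_affine.
Local Open Scope ereal_scope.
Context {R : realType}.
Notation mu := (@lebesgue_measure R).

Let affine (a b : R) : measurableTypeR R -> measurableTypeR R := fun x => (a * x + b)%R.

Let measurable_affine a b : measurable_fun setT (affine a b).
Proof. by apply: measurable_funD => //; apply: measurable_funM. Qed.

(** Lebesgue measure agrees with [|a|] times its image under the affine map on half-open intervals,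
    hence everywhere. For [a < 0] the preimage is closed on the other side, which does not change
    its length. *)
Lemma ge0_integral_affine (a b : R) (g : R -> \bar R) : a != 0%R ->
  measurable_fun setT g -> (forall x, 0 <= g x) ->
  \int[mu]_x g x = `|a|%:E * \int[mu]_x g (a * x + b)%R.
Proof.
move=> a0 mg g0.
have aN0 : (0 <= `|a|)%R by [].
have E A : measurable A -> mu A = mscale (NngNum aN0) (pushforward mu (affine a b)) A.
  apply: lebesgue_measure_unique => X [[u v]] _ <-.
  rewrite [RHS](_ : _ = `|a|%:E * mu (affine a b @^-1` `]u, v]))//.
  have [agt0|] := ltP 0%R a.
    rewrite (_ : affine a b @^-1` _ = `](u - b) / a, (v - b) / a]%classic)%R; last first.
      by apply/seteqP; split => x /=; rewrite !in_itv/= /affine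
        ltr_pdivrMr// ler_pdivlMr// ltrBlDr lerBrDr ![(x * a)%R]mulrC.
    rewrite !lebesgue_measure_itv/= !lte_fin ltr_pM2r ?invr_gt0// ltrD2r.
    case: ifPn => _; last by rewrite mule0.
    by rewrite -!EFinB -EFinM gtr0_norm//; congr EFin; field.
  rewrite le_eqVlt (negbTE a0)/= => alt0.
  rewrite (_ : affine a b @^-1` _ = `[(v - b) / a, (u - b) / a[%classic)%R; last first.
    by apply/seteqP; split => x /=; rewrite !in_itv/= /affine
      ltr_ndivlMr// ler_ndivrMr// ltrBlDr lerBrDr ![(x * a)%R]mulrC andbC.
  rewrite !lebesgue_measure_itv/= !lte_fin ltr_nM2r ?invr_lt0// ltrD2r.
  case: ifPn => _; last by rewrite mule0.
  by rewrite -!EFinB -EFinM ltr0_norm//; congr EFin; field; rewrite lt_eqF.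
rewrite (eq_measure_integral (mscale (NngNum aN0) (pushforward mu (affine a b)))); last first.
  by move=> A mA _; exact: E.
rewrite ge0_integral_mscale//; congr (_ * _).
by rewrite ge0_integral_pushforward.
Qed.

End lebesgue_affine.

(** Lets a product measure serve as a factor of the next product. Both exhaustions are taken
    increasing, so that one index works for both coordinates. *)
Lemma sigma_finite_product d1 d2 (T1 : measurableType d1) (T2 : measurableType d2)
    (R : realType) (m1 : {sigma_finite_measure set T1 -> \bar R})
    (m2 : {sigma_finite_measure set T2 -> \bar R}) : sigma_finite setT (m1 \x m2)%E.
Proof.
have /sigma_finiteP[F [FT ndF mF]] := sigma_finiteT m1.
have /sigma_finiteP[G [GT ndG mG]] := sigma_finiteT m2.
exists (fun n => F n `*` G n).
  apply/esym; rewrite -subTset => -[x y] _.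
  have [i _ Fx] : (\bigcup_i F i) x by rewrite -FT.
  have [j _ Gy] : (\bigcup_i G i) y by rewrite -GT.
  exists (maxn i j) => //; split => /=.
    by move: x Fx; apply/subsetPset/ndF/leq_maxl.
  by move: y Gy; apply/subsetPset/ndG/leq_maxr.
move=> n; have [mFn Fn] := mF n; have [mGn Gn] := mG n.
split; first exact: measurableX.
by rewrite product_measure1E// lte_mul_pinfty// ge0_fin_numE.
Qed.

(** * The iterated Lebesgue integral [lebI] and Tonelli's theorem *)

Section lebI_basic.
Local Open Scope ereal_scope.
Context {R : realType}.
Notation mu := (@lebesgue_measure R).

Lemma eq_lebI m (f g : m.-tuple R -> \bar R) : f =1 g -> lebI f = lebI g.
Proof. by move=> /funext ->. Qed.

Lemma lebI_ge0 m (f : m.-tuple R -> \bar R) : (forall t, 0 <= f t) -> 0 <= lebI f.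
Proof.
elim: m f => [|m IH] f f0 /=; first exact: f0.
by apply: integral_ge0 => x _; apply: IH.
Qed.

Lemma le_lebI m (f g : m.-tuple R -> \bar R) :
  (forall t, 0 <= f t) -> (forall t, f t <= g t) -> lebI f <= lebI g.
Proof.
elim: m f g => [|m IH] f g f0 fg /=; first exact: fg.
apply: le_integral_ge0 => x; first exact: lebI_ge0.
exact: IH.
Qed.

Lemma abse_lebI m (f : m.-tuple R -> \bar R) :
  `|lebI f| <= lebI (fun t => `|f t|).
Proof.
elim: m f => [|m IH] f //=.
apply: le_trans (abse_integral_le _ _) _.
by apply: le_integral_ge0 => x //; exact: IH.
Qed.

(* [lebI] is the integral for an iterated product of Lebesgue measures; the
   carrier is left abstract, so that no measure on tuples need be built. *)
Lemma lebI_integral m : exists (d : measure_display) (T : measurableType d)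
    (nu : {sigma_finite_measure set T -> \bar R}) (phi : T -> m.-tuple R),
  measurable_fun setT phi /\
  forall g : m.-tuple R -> \bar R, measurable_fun setT g -> (forall t, 0 <= g t) ->
    lebI g = \int[nu]_x g (phi x).
Proof.
elim: m => [|m [d [T [nu [phi [mphi IH]]]]]].
  exists _, unit, (\d_tt : {sigma_finite_measure set unit -> \bar R}), (fun=> [tuple]).
  split => // g mg g0; rewrite integral_dirac//=.
  by rewrite diracT mul1e.
pose M : {sigma_finite_measure set (measurableTypeR R * T)%type -> \bar R} :=
  HB.pack_for {sigma_finite_measure set (measurableTypeR R * T)%type -> \bar R} (mu \x nu)
    (Measure_isSigmaFinite.Build _ _ _ (mu \x nu) (sigma_finite_product mu nu)).
exists _, _, M,
  (fun z => cons_tuple z.1 (phi z.2)); split.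
  by apply: measurable_cons => //; exact: measurableT_comp.
move=> g mg g0.
have mc : measurable_fun setT (fun z : R * T => cons_tuple z.1 (phi z.2)).
  by apply: measurable_cons => //; exact: measurableT_comp.
rewrite fubini_tonelli1//=; last exact: (measurableT_comp mg).
apply: eq_integral => x _; rewrite /fubini_F/= IH//.
apply: measurableT_comp => //.
exact: (@measurable_cons _ _ _ _ (fun=> x) _ id).
Qed.

(** Measurability in a parameter is inherited from Tonelli's theorem for the measure hidden in
    [lebI_integral]. *)
Lemma measurable_lebI d' (X : measurableType d') m (g : X -> m.-tuple R -> \bar R) :
  measurable_fun setT (fun z : X * m.-tuple R => g z.1 z.2) ->
  (forall x t, 0 <= g x t) -> measurable_fun setT (fun x => lebI (g x)).
Proof.
move=> mg g0; have [d [T [nu [phi [mphi E]]]]] := lebI_integral m.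
have mgx x : measurable_fun setT (g x).
  by apply: (measurableT_comp mg (g := fun t => (x, t))); exact: measurable_pair1.
rewrite (_ : (fun x => _) = fun x => \int[nu]_y g x (phi y)); last first.
  by apply/funext => x; rewrite E.
apply: (@measurable_fun_fubini_tonelli_F _ _ _ _ _ nu (fun z => g z.1 (phi z.2))) => //=.
apply: (measurableT_comp mg (g := fun z : X * T => (z.1, phi z.2))).
by apply: measurable_fun_pair => //; exact: (measurableT_comp mphi).
Qed.

End lebI_basic.

Lemma measurable_fun_comp2 d d1 d2 d3 (T : measurableType d) (T1 : measurableType d1)
    (T2 : measurableType d2) (T3 : measurableType d3) (g : T1 -> T2 -> T3) u v :
  measurable_fun setT (fun z : T1 * T2 => g z.1 z.2) ->
  measurable_fun [set: T] u -> measurable_fun [set: T] v ->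
  measurable_fun [set: T] (fun x => g (u x) (v x)).
Proof.
move=> mg mu mv; apply: (measurableT_comp mg (g := fun x => (u x, v x))).
exact: measurable_fun_pair.
Qed.

Ltac measurable_real := repeat first
  [ exact: measurable_cst | exact: measurable_id | exact: measurable_fst
  | exact: measurable_snd | exact: measurable_tnth | assumption
  | exact: (measurableT_comp measurable_fst measurable_fst)
  | exact: (measurableT_comp measurable_snd measurable_fst)
  | apply: measurable_funB | apply: measurable_funD | apply: measurable_funM
  | apply: measurable_funX ].

Lemma tonelli (R : realType) (g : R -> R -> \bar R) :
  measurable_fun setT (fun z : R * R => g z.1 z.2) -> (forall x y, 0 <= g x y)%E ->
  (\int[@lebesgue_measure R]_x \int[@lebesgue_measure R]_y g x y =
   \int[@lebesgue_measure R]_y \int[@lebesgue_measure R]_x g x y)%E.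
Proof.
move=> mg g0; exact: (@fubini_tonelli _ _ _ _ _ (@lebesgue_measure R)
  (@lebesgue_measure R) (fun z => g z.1 z.2) mg (fun z => g0 z.1 z.2)).
Qed.

Lemma measurable_integral2 (R : realType) (g : R -> R -> \bar R) :
  measurable_fun setT (fun z : R * R => g z.1 z.2) -> (forall x y, 0 <= g x y)%E ->
  measurable_fun setT (fun x => \int[@lebesgue_measure R]_y g x y)%E.
Proof.
move=> mg g0; exact: (@measurable_fun_fubini_tonelli_F _ _ _ _ _
  (@lebesgue_measure R) (fun z => g z.1 z.2) mg (fun z => g0 z.1 z.2)).
Qed.

(** * Rotations of the plane *)

Section rotation.
Local Open Scope ereal_scope.
Context {R : realType}.
Notation mu := (@lebesgue_measure R).

(** A rotation factors into shears and dilations that each change one variable, so one-variable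
    substitutions and an exchange of integrals suffice; the Jacobians [|a|^-1] and [|a|] cancel. *)
Lemma integral_rotation (a b : R) (g : R -> R -> \bar R) : (a ^+ 2 + b ^+ 2 = 1)%R ->
  measurable_fun setT (fun z : R * R => g z.1 z.2) -> (forall x y, 0 <= g x y) ->
  \int[mu]_x \int[mu]_y g (a * x + b * y)%R (- b * x + a * y)%R =
  \int[mu]_x \int[mu]_y g x y.
Proof.
move=> ab mg g0.
have mg1 x : measurable_fun setT (g x).
  by apply: (measurable_fun_comp2 mg) => //; measurable_real.
have mg2 y : measurable_fun setT (g ^~ y).
  by apply: (measurable_fun_comp2 mg) => //; measurable_real.
have mg' : measurable_fun setT (fun z : R * R => g z.2 z.1).
  by apply: (measurable_fun_comp2 mg); measurable_real.
rewrite [RHS]tonelli//.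
(* For [a = 0] the shears degenerate, and the rotation merely swaps the axes up to sign. *)
have [a0|a0] := eqVneq a 0%R.
  have b0 : b != 0%R.
    by apply/eqP => b0; move: ab; rewrite a0 b0 => /eqP; rewrite expr0n addr0 eq_sym oner_eq0.
  have b1 : `|b|%R = 1%R.
    by apply/eqP; rewrite -sqrp_eq1//; move: ab; rewrite a0 expr0n add0r real_normK ?num_real// => ->.
  transitivity (\int[mu]_x \int[mu]_y g y (- b * x)%R).
    apply: eq_integral => x _.
    rewrite [RHS](ge0_integral_affine (a := b) 0%R)// b1 mul1e.
    by apply: eq_integral => y _; rewrite a0 !mul0r add0r !addr0.
  rewrite [RHS](ge0_integral_affine (a := (- b)%R) 0%R) ?oppr_eq0//.
  - by rewrite normrN b1 mul1e; apply: eq_integral => x _; rewrite addr0.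
  - exact: (measurable_integral2 mg').
  - by move=> y; apply: integral_ge0.
have na : (`|a| != 0)%R by rewrite normr_eq0.
(* Expresses the new first coordinate through [x] and the new second coordinate [v = a y - b x], so
   that [y] can be traded for [v] while [x] is kept. *)
have key (x y : R) : (a * x + b * y = a^-1 * x + a^-1 * b * (a * y + - b * x))%R.
  have -> : (a^-1 * x = a^-1 * ((a ^+ 2 + b ^+ 2) * x))%R by rewrite ab mul1r.
  by field.
transitivity (\int[mu]_x (`|a|^-1%:E * \int[mu]_v g (a^-1 * x + a^-1 * b * v)%R v)).
  apply: eq_integral => x _.
  rewrite [in RHS](ge0_integral_affine (a := a) (- b * x)%R)//; last first.
    by apply: (measurable_fun_comp2 mg) => //; measurable_real.
  rewrite muleA -EFinM mulVf// mul1e; apply: eq_integral => y _.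
  by rewrite [(- b * x + _)%R]addrC; congr (g _ _); exact: key.
have mG : measurable_fun setT (fun z : R * R => g (a^-1 * z.1 + a^-1 * b * z.2)%R z.2).
  by apply: (measurable_fun_comp2 mg) => //; measurable_real.
rewrite ge0_integralZl_EFin ?invr_ge0//; first last.
- exact: (measurable_integral2 mG).
- by move=> x _; apply: integral_ge0.
rewrite (tonelli (g := fun x y => g (a^-1 * x + a^-1 * b * y)%R y))//=.
rewrite -ge0_integralZl_EFin ?invr_ge0//; first last.
- apply: (measurable_integral2 (g := fun y x => g (a^-1 * x + a^-1 * b * y)%R y)) => //.
  by apply: (measurable_fun_comp2 mg); measurable_real.
- by move=> x _; apply: integral_ge0.
apply: eq_integral => y _.
by rewrite [RHS](ge0_integral_affine (a := (a^-1)%R) (a^-1 * b * y)%R) ?invr_eq0// normrV ?unitfE.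
Qed.

End rotation.

(** * Tuples as row vectors *)

Section tuple_vectors.
Context {R : realType}.

Definition tdot m (l t : m.-tuple R) : R := \sum_i tnth l i * tnth t i.

Lemma tdot_cons m x y (l t : m.-tuple R) :
  tdot (cons_tuple x l) (cons_tuple y t) = x * y + tdot l t.
Proof.
rewrite /tdot big_ord_recl !tnth0; congr (_ + _).
by apply: eq_bigr => i _; rewrite !tnthS.
Qed.

Lemma tdot0 (l t : 0.-tuple R) : tdot l t = 0.
Proof. by rewrite /tdot big_ord0. Qed.

Lemma tdot_ge0 m (t : m.-tuple R) : 0 <= tdot t t.
Proof. by apply: sumr_ge0 => i _; rewrite -expr2 sqr_ge0. Qed.

Lemma measurable_tnth_comp d (T : measurableType d) m (u : T -> m.-tuple R) i :
  measurable_fun setT u -> measurable_fun setT (fun x => tnth (u x) i).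
Proof.
by move=> mu; apply: (measurableT_comp (f := fun t => tnth t i) _ mu); exact: measurable_tnth.
Qed.

Lemma measurable_tsq d (T : measurableType d) m (u : T -> m.-tuple R) :
  measurable_fun setT u -> measurable_fun setT (fun x => tdot (u x) (u x)).
Proof.
move=> mu; apply: measurable_sum => i; apply: measurable_funM => //;
exact: measurable_tnth_comp.
Qed.

Definition tvec m (v : 'rV[R]_m) : m.-tuple R := [tuple v 0 i | i < m].

Lemma tvecK m : cancel (@tvec m) (@rv_of_tuple R m).
Proof. by move=> v; apply/rowP => i; rewrite mxE tnth_mktuple. Qed.

Lemma rv_of_tupleK m : cancel (@rv_of_tuple R m) (@tvec m).
Proof. by move=> t; apply: eq_from_tnth => i; rewrite tnth_mktuple mxE. Qed.

Lemma rv_of_tuple_cons m x (t : m.-tuple R) :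
  rv_of_tuple (cons_tuple x t) = row_mx x%:M (rv_of_tuple t) :> 'rV_(1 + m).
Proof.
apply/rowP => i; rewrite !mxE; case: splitP => j ji.
  by rewrite (_ : i = ord0) ?tnth0 ?ord1 ?mxE ?mulr1n//; apply: val_inj; rewrite /= ji ord1.
rewrite (_ : i = lift ord0 j) ?tnthS ?mxE//.
by apply: val_inj; rewrite /= ji.
Qed.

Lemma tvec_row_mx m y (v : 'rV[R]_m) :
  tvec (row_mx y%:M v : 'rV_(1 + m)) = cons_tuple y (tvec v).
Proof. by apply: (can_inj (@rv_of_tupleK _)); rewrite rv_of_tuple_cons !tvecK. Qed.

Lemma dotv_tvec m (u v : 'rV[R]_m) : dotv u v = tdot (tvec u) (tvec v).
Proof. by apply: eq_bigr => i _; rewrite !tnth_mktuple. Qed.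

Lemma dotvE m (u v : 'rV[R]_m) : dotv u v = (u *m v^T) 0 0.
Proof. by rewrite mxE; apply: eq_bigr => i _; rewrite mxE. Qed.

Lemma dotv_ge0 m (u : 'rV[R]_m) : 0 <= dotv u u.
Proof. by rewrite dotv_tvec tdot_ge0. Qed.

Lemma dotv_eq0 m (u : 'rV[R]_m) : (dotv u u == 0) = (u == 0).
Proof.
apply/eqP/eqP => [|->]; last by rewrite dotvE mul0mx mxE.
move=> /eqP; rewrite psumr_eq0 => [/allP u0|i _]; last by rewrite -expr2 sqr_ge0.
apply/rowP => i; rewrite mxE; apply/eqP.
by have := u0 i (mem_index_enum i); rewrite -expr2 sqrf_eq0.
Qed.

Definition tadd m (t : m.-tuple R) (v : 'rV[R]_m) := tvec (rv_of_tuple t + v).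

Definition tmulmx m (t : m.-tuple R) (B : 'M[R]_m) := tvec (rv_of_tuple t *m B).

Lemma measurable_tvec d (T : measurableType d) m (u : T -> 'rV[R]_m) :
  (forall i, measurable_fun setT (fun x => u x 0 i)) ->
  measurable_fun setT (fun x => tvec (u x)).
Proof.
move=> mu; apply/measurable_fun_tnthP => i.
by rewrite (_ : _ \o _ = fun x => u x 0 i)//; apply/funext => x /=; rewrite tnth_mktuple.
Qed.

Lemma measurable_mulmx_entry d (T : measurableType d) m n (u : T -> m.-tuple R)
    (A : 'M[R]_(m, n)) i :
  measurable_fun setT u -> measurable_fun setT (fun x => (rv_of_tuple (u x) *m A) 0 i).
Proof.
move=> mu; rewrite (_ : (fun _ => _) = fun x => \sum_j tnth (u x) j * A j i); last first.
  by apply/funext => x; rewrite !mxE; apply: eq_bigr => j _; rewrite mxE.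
apply: measurable_sum => j; apply: measurable_funM => //.
exact: measurable_tnth_comp.
Qed.

End tuple_vectors.

(** * Linear changes of variables in [lebI] *)

Section lebI_change_of_variables.
Local Open Scope ereal_scope.
Context {R : realType}.
Notation mu := (@lebesgue_measure R).

Lemma measurable_lebI_cons m (g : m.+1.-tuple R -> \bar R) :
  measurable_fun setT g ->
  measurable_fun setT (fun z : R * m.-tuple R => g (cons_tuple z.1 z.2)).
Proof.
move=> mg; apply: (measurableT_comp mg (g := fun z : R * m.-tuple R => cons_tuple z.1 z.2)).
exact: measurable_cons.
Qed.

Lemma measurable_cons1 m (g : m.+1.-tuple R -> \bar R) x :
  measurable_fun setT g -> measurable_fun setT (fun t : m.-tuple R => g (cons_tuple x t)).
Proof.
move=> mg; apply: (measurableT_comp mg (g := fun t : m.-tuple R => cons_tuple x t)).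
exact: (@measurable_cons _ _ _ _ (fun=> x) _ id).
Qed.

Lemma lebI_tadd m (v : 'rV[R]_m) (g : m.-tuple R -> \bar R) :
  measurable_fun setT g -> (forall t, 0 <= g t) ->
  lebI (fun t => g (tadd t v)) = lebI g.
Proof.
elim: m v g => [|m IH] v g mg g0; first by rewrite /=; congr g; exact: tuple0.
rewrite [RHS]/= [RHS](ge0_integral_affine (a := 1%R) (v 0%R 0%R))//; first last.
- by move=> x; apply: lebI_ge0.
- by apply: (measurable_lebI (measurable_lebI_cons mg)).
rewrite normr1 mul1e /=; apply: eq_integral => x _.
rewrite -(IH (@rsubmx _ 1 1 m v) (fun t => g (cons_tuple (1 * x + v 0%R 0%R)%R t)))//; last exact: measurable_cons1.
apply: eq_lebI => t; congr g.
apply: eq_from_tnth => i; case: (unliftP ord0 i) => [j|] ->.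
  by rewrite tnthS !tnth_mktuple !mxE tnthS; congr (_ + v _ _)%R; exact: val_inj.
by rewrite tnth0 tnth_mktuple !mxE tnth0 mul1r.
Qed.

Lemma lebI_scale m (r : R) (g : m.-tuple R -> \bar R) : (0 < r)%R ->
  measurable_fun setT g -> (forall t, 0 <= g t) ->
  lebI g = (r ^+ m)%:E * lebI (fun t => g (tvec (r *: rv_of_tuple t))).
Proof.
move=> r0; elim: m g => [|m IH] g mg g0.
  by rewrite /= expr0 mul1e; congr g; exact/esym/tuple0.
have mZ k : measurable_fun setT (fun t : k.-tuple R => tvec (r *: rv_of_tuple t)).
  apply: measurable_tvec => i.
  rewrite (_ : (fun _ => _) = fun t => r * tnth t i)%R; last by apply/funext => x; rewrite !mxE.
  by apply: measurable_funM => //; exact: measurable_tnth.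
rewrite [LHS]/= [LHS](ge0_integral_affine (a := r) 0%R) ?gt_eqF//; first last.
- by move=> x; apply: lebI_ge0.
- by apply: (measurable_lebI (measurable_lebI_cons mg)).
rewrite gtr0_norm// exprS EFinM -muleA; congr (_ * _).
rewrite /= -ge0_integralZl_EFin ?exprn_ge0 ?ltW//; first last.
- by apply: (measurable_lebI (g := fun x t => g (tvec (r *: rv_of_tuple (cons_tuple x t))))) => //;
  apply: (measurable_lebI_cons (g := fun t => g (tvec (r *: rv_of_tuple t)))); exact: (measurableT_comp mg (mZ _)).
- by move=> x _; apply: lebI_ge0.
apply: eq_integral => x _; rewrite addr0 IH//; last exact: measurable_cons1.
congr (_ * _); apply: eq_lebI => t; congr g.
rewrite -tvec_row_mx rv_of_tuple_cons; congr tvec.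
transitivity (row_mx (r *: x%:M) (r *: rv_of_tuple t)); last exact/esym/(@scale_row_mx R 1 1 m).
by rewrite scale_scalar_mx.
Qed.

Lemma orthonormal_col_mx m n (p : 'rV[R]_n) (Q : 'M[R]_(m, n)) :
  p *m p^T = 1%:M -> p *m Q^T = 0%R -> Q *m Q^T = 1%:M ->
  col_mx p Q *m (col_mx p Q)^T = 1%:M.
Proof.
move=> pp pQ QQ; rewrite tr_col_mx mul_col_row pp pQ QQ.
by rewrite -[X in block_mx _ _ X _]trmxK trmx_mul trmxK pQ trmx0 -scalar_mx_block.
Qed.

(* Gram--Schmidt from the last row upwards makes the change of basis upper
   triangular, so that it only translates and rescales each iterated integral. *)
Lemma lebI_orthonormalise m n (A : 'M[R]_(m, n)) : row_free A ->
  exists B : 'M[R]_m, (B *m A) *m (B *m A)^T = 1%:M /\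
  forall g : m.-tuple R -> \bar R, measurable_fun setT g -> (forall t, 0 <= g t) ->
    lebI g = `|\det B|%:E * lebI (fun t => g (tmulmx t B)).
Proof.
elim: m n A => [|m IH] n A Afree.
  exists 1%:M; split; first by apply/matrixP => -[].
  by move=> g mg g0; rewrite det1 normr1 mul1e /=; congr g; exact/esym/tuple0.
pose a := @usubmx _ 1 m n A; pose A' := @dsubmx _ 1 m n A.
have AE : A = col_mx a A' by rewrite vsubmxK.
have A'free : row_free A'.
  rewrite -kermx_eq0; apply/rowV0P => y /sub_kermxP yA'.
  have : (row_mx (0 : 'rV_1) y *m A = 0)%R by rewrite AE mul_row_col mul0mx add0r.
  rewrite -(mul0mx 1 A) => /(row_free_inj Afree)/(congr1 (@rsubmx _ 1 1 m)).
  by rewrite row_mxKr => ->; apply/rowP => i; rewrite !mxE.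
have [B' [B'o B'l]] := IH _ _ A'free.
set Q := (B' *m A')%R in B'o.
(* The orthogonal projection of the first row onto the row space of [A'] is [a *m Q^T *m Q]; [w]
   holds its coefficients in the rows of [A'], and [p] below is the residual. *)
pose w := (a *m Q^T *m B')%R.
pose p := (a - w *m A')%R.
have p0 : p != 0%R.
  apply/eqP => p0.
  have : (row_mx 1%:M (- w) *m A = 0)%R by rewrite AE mul_row_col mul1mx mulNmx.
  rewrite -(mul0mx 1 A) => /(row_free_inj Afree)/(congr1 (@lsubmx _ 1 1 m)).
  by rewrite row_mxKl => /matrixP/(_ 0%R 0%R)/eqP; rewrite !mxE oner_eq0.
have pQ : (p *m Q^T = 0)%R.
  by rewrite /p mulmxBl /w -(mulmxA (a *m Q^T) B' A') -/Q -(mulmxA (a *m Q^T) Q) B'o mulmx1 subrr.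
have pp : (0 < dotv p p)%R by rewrite lt_def dotv_eq0 p0 dotv_ge0.
pose be : R := ((Num.sqrt (dotv p p))^-1)%R.
have be0 : (0 < be)%R by rewrite invr_gt0 sqrtr_gt0.
pose B : 'M[R]_(1 + m) := block_mx be%:M (- be *: w) 0 B'.
have BA : (B *m A = col_mx (be *: p) Q)%R.
  rewrite AE mul_block_col mul0mx add0r; congr col_mx.
  by rewrite mul_scalar_mx -scalemxAl scaleNr -scalerBr.
exists B; split.
  rewrite BA; apply: orthonormal_col_mx => //; last by rewrite -scalemxAl pQ scaler0.
  rewrite linearZ/= -scalemxAl -scalemxAr (mx11_scalar (p *m p^T)) -dotvE scalerA.
  rewrite scale_scalar_mx -expr2 /be exprVn sqr_sqrtr ?dotv_ge0// mulVf// gt_eqF//.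
move=> g mg g0.
have mM k (C : 'M[R]_k) : measurable_fun setT (fun t : k.-tuple R => tmulmx t C).
  by apply: measurable_tvec => i; apply: measurable_mulmx_entry.
rewrite [LHS]/= [LHS](ge0_integral_affine (a := be) 0%R) ?gt_eqF//; first last.
- by move=> x; apply: lebI_ge0.
- by apply: (measurable_lebI (measurable_lebI_cons mg)).
have -> : \det B = (be * \det B')%R by rewrite /B det_ublock det_scalar1.
rewrite normrM EFinM -muleA; congr (_ * _).
rewrite /= -ge0_integralZl_EFin//; first last.
- by apply: (measurable_lebI (g := fun x t => g (tmulmx (cons_tuple x t) B))) => //;
  apply: (measurable_lebI_cons (g := fun t => g (tmulmx t B))); exact: (measurableT_comp mg (mM _ B)).
- by move=> x _; apply: lebI_ge0.
apply: eq_integral => x _; rewrite addr0.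
have mg1 : measurable_fun setT (fun t => g (cons_tuple (be * x)%R t)) by exact: measurable_cons1.
(* For fixed [x] the off-diagonal block of [B] only translates the inner variables, so it leaves the
   inner integral unchanged. *)
rewrite -(lebI_tadd (x *: (- be *: w))%R)//.
rewrite B'l//; last first.
  apply: (measurableT_comp mg1 (g := fun t => tadd t _)).
  apply: measurable_tvec => i.
  rewrite (_ : (fun _ => _) = fun t : m.-tuple R => tnth t i + (x *: (- be *: w)) 0 i)%R;
    last by apply/funext => t; rewrite !mxE.
  by apply: measurable_funD => //; exact: measurable_tnth.
congr (_ * _); apply: eq_lebI => t; congr g.
rewrite /tmulmx rv_of_tuple_cons.
have -> : row_mx x%:M (rv_of_tuple t) *m B =
    row_mx (be * x)%:M (x *: (- be *: w) + rv_of_tuple t *m B')%R.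
  by rewrite /B mul_row_block mulmx0 addr0 -scalar_mxM mul_scalar_mx mulrC.
by rewrite tvec_row_mx /tadd tvecK addrC.
Qed.

(** By induction the inner part of the linear form becomes a multiple of one coordinate; rotating
    that coordinate against the outer one aligns the form with the first axis, and only its length
    survives. *)
Lemma lebI_rotation m (l : m.+1.-tuple R) (Phi : R -> R -> \bar R) :
  measurable_fun setT (fun z : R * R => Phi z.1 z.2) -> (forall x y, 0 <= Phi x y) ->
  lebI (fun t => Phi (tdot t t) (tdot l t)) =
  lebI (fun t : m.+1.-tuple R => Phi (tdot t t) (Num.sqrt (tdot l l) * thead t)%R).
Proof.
elim: m l Phi => [|m IH] l Phi mPhi Phi0.
  have mP : measurable_fun setT (fun x : R => Phi (x * x)%R (Num.sqrt (tdot l l) * x)%R).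
    by apply: (measurable_fun_comp2 mPhi); measurable_real.
  case/tupleP: l mP => l0 l; rewrite (tuple0 l) {l} => mP.
  transitivity (\int[mu]_x Phi (x * x)%R (l0 * x)%R).
    by apply: eq_integral => x _; rewrite /= !tdot_cons !tdot0 !addr0.
  transitivity (\int[mu]_x Phi (x * x)%R (`|l0| * x)%R); last first.
    by apply: eq_integral => x _; rewrite /= !tdot_cons !tdot0 !addr0 theadE -expr2 sqrtr_sqr.
  (* In dimension one only a sign has to be removed, by the reflection [x -> - x]. *)
  have [l00|l00] := leP 0%R l0; first by rewrite ger0_norm.
  rewrite ltr0_norm// [RHS](ge0_integral_affine (a := (-1)%R) 0%R) ?oppr_eq0 ?oner_eq0//.
    by rewrite normrN1 mul1e; apply: eq_integral => x _; congr Phi; ring.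
  by apply: (measurable_fun_comp2 mPhi); measurable_real.
case/tupleP: l => l0 l; set lam := Num.sqrt (tdot l l).
set c := Num.sqrt (tdot [tuple of l0 :: l] [tuple of l0 :: l]).
have cE : (c ^+ 2 = l0 ^+ 2 + lam ^+ 2)%R.
  by rewrite /c /lam !sqr_sqrtr ?tdot_ge0// tdot_cons expr2.
pose g u v := lebI (fun t : m.-tuple R => Phi (u ^+ 2 + v ^+ 2 + tdot t t)%R (c * u)%R).
have mg : measurable_fun setT (fun z : R * R => g z.1 z.2).
  apply: (measurable_lebI (g := fun (z : R * R) (t : m.-tuple R) => Phi (z.1 ^+ 2 + z.2 ^+ 2 + tdot t t)%R (c * z.1)%R)) => //.
  apply: (measurable_fun_comp2 mPhi).
    apply: measurable_funD; last exact: measurable_tsq.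
    by measurable_real.
  by measurable_real.
have g0 u v : 0 <= g u v by apply: lebI_ge0.
transitivity (\int[mu]_x \int[mu]_y lebI (fun t : m.-tuple R =>
    Phi (x ^+ 2 + y ^+ 2 + tdot t t)%R (l0 * x + lam * y)%R)).
  apply: eq_integral => x _.
  transitivity (lebI (fun t : m.+1.-tuple R => Phi (x * x + tdot t t)%R (l0 * x + tdot l t)%R)).
    change (lebI (fun t : m.+1.-tuple R => Phi (tdot (cons_tuple x t) (cons_tuple x t))
      (tdot (cons_tuple l0 l) (cons_tuple x t))) =
      lebI (fun t : m.+1.-tuple R => Phi (x * x + tdot t t)%R (l0 * x + tdot l t)%R)).
    by apply: eq_lebI => t; rewrite !tdot_cons.
  rewrite (IH l (fun q r => Phi (x * x + q)%R (l0 * x + r)%R))//.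
    by apply: eq_integral => y _; apply: eq_lebI => t; rewrite theadE tdot_cons addrA !expr2.
  by apply: (measurable_fun_comp2 mPhi); measurable_real.
transitivity (\int[mu]_x \int[mu]_y g x y); last first.
  apply: eq_integral => x _; apply: eq_integral => y _; apply: eq_lebI => t.
  by rewrite theadE !tdot_cons addrA !expr2.
(* If [c = 0] there is no direction to rotate, but then both linear forms vanish. *)
have [c0|c0] := eqVneq c 0%R.
  have [l00 lam0] : l0 = 0%R /\ lam = 0%R.
    move/eqP: cE; rewrite c0 expr0n eq_sym paddr_eq0 ?sqr_ge0// !sqrf_eq0 => /andP[/eqP-> /eqP->].
    by [].
  by rewrite /g c0 l00 lam0; apply: eq_integral => x _; apply: eq_integral => y _;
    apply: eq_lebI => t; rewrite !mul0r addr0.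
have c20 : (c ^+ 2 != 0)%R by rewrite sqrf_eq0.
rewrite -(integral_rotation (a := (l0 / c)%R) (b := (lam / c)%R) (g := g))//; last first.
  by rewrite !expr_div_n -mulrDl -cE divff.
apply: eq_integral => x _; apply: eq_integral => y _; apply: eq_lebI => t.
congr Phi; last by field.
congr (_ + _)%R; rewrite -[LHS]mul1r -[X in (X * _ = _)%R](divff c20) [X in (X / _)%R]cE; field.
by rewrite c0.
Qed.

Definition box m (v : m.-tuple R) (r : R) : set (m.-tuple R) :=
  [set t | forall i, (`|tnth t i - tnth v i| <= r)%R].

(** Cubes serve as the yardstick: they bound the volume of the ball on both sides, and they show
    that a neighbourhood of a matrix is not negligible. *)
Lemma lebI_box m (v : m.-tuple R) (r : R) : (0 < r)%R ->
  lebI (fun t => (\1_(box v r) t)%:E) = ((r *+ 2) ^+ m)%:E.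
Proof.
move=> r0; elim: m v => [|m IH] v.
  by rewrite /= indicE mem_set//; case.
case/tupleP: v => v0 v.
have boxE x t : box [tuple of v0 :: v] r (cons_tuple x t) <->
    (`|x - v0| <= r)%R /\ box v r t.
  split=> [b|[b0 b] i].
    by split; [have := b ord0; rewrite !tnth0|move=> i; have := b (lift ord0 i); rewrite !tnthS].
  by case: (unliftP ord0 i) => [j|] ->; rewrite ?tnthS ?tnth0.
rewrite /= (_ : (fun x => _) = fun x => ((r *+ 2) ^+ m)%:E * (\1_(`[(v0 - r)%R, (v0 + r)%R]%classic : set R) x)%:E); last first.
  apply/funext => x; rewrite !indicE.
  have -> : (x \in (`[(v0 - r)%R, (v0 + r)%R]%classic : set R)) = (`|x - v0| <= r)%R.
    by rewrite mem_setE in_itv/= ler_distl.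
  case: (boolP (`|x - v0| <= r)%R) => xr /=; rewrite ?mule1 ?mule0.
    rewrite -(IH v); apply: eq_lebI => t; rewrite !indicE; congr ((nat_of_bool _)%:R)%:E.
    by apply/idP/idP; rewrite !inE boxE; [case|].
  rewrite (_ : (fun t => _) = fun=> 0).
    elim: m {IH v boxE} => [//|m IHm] /=.
    by under eq_integral do rewrite IHm; rewrite integral0.
  apply/funext => t; rewrite indicE memNset// boxE => -[xr' _].
  by rewrite xr' in xr.
rewrite ge0_integralZl_EFin ?exprn_ge0 ?mulrn_wge0 ?ltW//; last first.
  by apply/measurable_EFinP; exact: measurable_indic.
rewrite integral_indic//= setIT lebesgue_measure_itv/= lte_fin ifT; last by lra.
by rewrite -EFinB -EFinM exprSr; congr EFin; congr (_ * _)%R; ring.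
Qed.

End lebI_change_of_variables.

(** * Layer cake formula and power densities on the line *)

Section one_dimensional.
Local Open Scope ereal_scope.
Context {R : realType}.
Notation mu := (@lebesgue_measure R).

Lemma ge0_layer (y : \bar R) : 0 <= y ->
  y = \int[mu]_s (if (0 <= s)%R && (s%:E < y) then 1 else 0).
Proof.
move=> y0.
pose A : set R := [set s | (0 <= s)%R && (s%:E < y)].
rewrite (_ : (fun s => _) = fun s => (\1_A s)%:E); last first.
  apply/funext => s; rewrite indicE; case: ifPn => sA; first by rewrite mem_set.
  by rewrite memNset//; exact/negP.
have [AE lA] : measurable A /\ mu A = y.
  case: y y0 @A => [y| |]//= y0.
    rewrite (_ : [set s | _] = `[0%R, y[%classic); last first.
      by apply/seteqP; split => s /=; rewrite in_itv/= lte_fin.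
    split => //; rewrite lebesgue_measure_itv/=; case: ifPn => [_|]; first by rewrite sube0.
    by rewrite lte_fin -leNgt => y0'; apply/eqP; rewrite eq_le; apply/andP; split.
  rewrite (_ : [set s | _] = `[0%R, +oo[%classic); last first.
    by apply/seteqP; split => s /=; rewrite in_itv/= ltry.
  by split => //; rewrite lebesgue_measure_itv/= ltry sube0.
by rewrite integral_indic//= setIT; exact/esym.
Qed.

Lemma measurable_layer d (T : measurableType d) (g : T -> \bar R) :
  measurable_fun setT g ->
  measurable_fun setT (fun z : T * R =>
    (if (0 <= z.2)%R && (z.2%:E < g z.1) then 1 else 0) : \bar R).
Proof.
move=> mg; apply: measurable_fun_ifT => //; apply: measurable_and.
  by apply: measurable_fun_ler => //; measurable_real.
apply: measurable_fun_lte; first by apply: (measurableT_comp (f := EFin)) => //; exact: measurable_snd.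
by apply: (measurableT_comp mg); exact: measurable_fst.
Qed.

(** Writing [g x] as the length of [[0, g x[] and exchanging integrals reduces identities between
    integrals to identities for superlevel sets. *)
Lemma ge0_integral_layer_cake d (T : measurableType d)
    (m : {sigma_finite_measure set T -> \bar R}) (f g : T -> \bar R) :
  measurable_fun setT f -> (forall x, 0 <= f x) ->
  measurable_fun setT g -> (forall x, 0 <= g x) ->
  \int[m]_x (g x * f x) =
  \int[mu]_s \int[m]_x ((if (0 <= s)%R && (s%:E < g x) then 1 else 0) * f x).
Proof.
move=> mf f0 mg g0.
pose L (z : T * R) : \bar R := (if (0 <= z.2)%R && (z.2%:E < g z.1) then 1 else 0) * f z.1.
have mL : measurable_fun setT L.
  apply: emeasurable_funM; first exact: measurable_layer.
  by apply: (measurableT_comp mf); exact: measurable_fst.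
have L0 z : 0 <= L z by rewrite mule_ge0//; case: ifP.
rewrite -(@fubini_tonelli _ _ _ _ _ m mu L mL L0).
apply: eq_integral => x _; rewrite /L/= ge0_integralZr//; first by rewrite -ge0_layer.
- by apply: (measurableT_comp (measurable_layer mg) (g := fun s => (x, s))); exact: measurable_pair1.
- by move=> s _; case: ifP.
Qed.

(** Open rays are stable under intersection and generate the Borel sets. Hence the law of [tdot t t]
    is determined by the volumes of centred balls. *)
Lemma measure_open_ray_unique (m1 m2 : {measure set (measurableTypeR R) -> \bar R}) :
  (forall x, m1 `]-oo, x[%classic < +oo) ->
  (forall x, m1 `]-oo, x[%classic = m2 `]-oo, x[%classic) ->
  forall A, measurable A -> m1 A = m2 A.
Proof.
move=> fin eq A mA.
apply: (@measure_unique _ R (measurableTypeR R) (@RGenInftyO.G R)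
  (fun n => `]-oo, (n%:R : R)[%classic) _ _ _ _ m1 m2 _ _ A mA) => //.
- exact: RGenInftyO.measurableE.
- move=> _ _ [x ->] [y ->]; exists (Num.min x y).
  by apply/seteqP; split => z /=; rewrite !in_itv/= lt_min => /andP.
- by move=> n; exists n%:R.
- apply/seteqP; split => // x _; exists (Num.truncn (Num.max (x : R) 0%R)).+1 => //=.
  rewrite in_itv/=; apply: le_lt_trans (truncnS_gt _).
  by rewrite le_max lexx.
- by move=> _ [x ->].
Qed.

(* The density of the squared norm for Lebesgue measure on [R^d], up to a constant. *)
Definition chi_density (d : nat) (x : R) : R :=
  if (0 < x)%R then (x `^ (d%:R / 2 - 1))%R else 0%R.

Lemma chi_density_ge0 d x : (0 <= chi_density d x)%R.
Proof. by rewrite /chi_density; case: ifP => // _; exact: powR_ge0. Qed.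

Lemma measurable_chi_density d : measurable_fun setT (chi_density d).
Proof.
by apply: measurable_fun_ifT => //=; exact: measurable_fun_ltr.
Qed.

Lemma measurable_chi_density_comp d' (T : measurableType d') d (u : T -> R) :
  measurable_fun setT u -> measurable_fun setT (fun x => (chi_density d (u x))%:E).
Proof.
move=> mu; apply: (measurableT_comp (f := EFin)) => //.
exact: (measurableT_comp (measurable_chi_density d) mu).
Qed.

Lemma chi_densityM d (r x : R) : (0 < r)%R ->
  chi_density d (r * x) = (r `^ (d%:R / 2 - 1) * chi_density d x)%R.
Proof.
move=> r0; rewrite /chi_density pmulr_rgt0//; case: ifPn => x0; last by rewrite mulr0.
by rewrite powRM// ltW.
Qed.

Lemma integral_powR (e a b : R) : (0 < e)%R -> (0 < a)%R -> (a < b)%R ->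
  \int[mu]_(x in `[a, b]) (x `^ (e - 1))%:E = ((b `^ e - a `^ e) / e)%:E.
Proof.
move=> e0 a0 ab.
have dF (x : R) : (0 < x)%R -> is_derive x (1%R : R) (fun y : R => e^-1 * y `^ e)%R (x `^ (e - 1))%R.
  move=> x0; have := is_derive1_powR e x0 => H.
  have := @is_deriveZ _ _ _ _ (e^-1)%R x 1%R _ H.
  rewrite (_ : e^-1 *: (e * _) = x `^ (e - 1))%R; last first.
    by rewrite /GRing.scale/= mulrA mulVf ?mul1r// gt_eqF.
  by [].
have cF (x : R) : (0 < x)%R -> {for x, continuous (fun y : R => e^-1 * y `^ e)%R}.
  move=> x0; apply: differentiable_continuous; apply/derivable1_diffP.
  by have [] := dF x x0.
rewrite (@continuous_FTC2 _ _ (fun y => e^-1 * y `^ e)%R)//.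
- by rewrite -EFinB; congr EFin; ring.
- apply: continuous_in_subspaceT => x; rewrite inE/= in_itv/= => /andP[ax _].
  have x0 : (0 < x)%R by exact: lt_le_trans ax.
  apply: differentiable_continuous; apply/derivable1_diffP.
  by have [] := is_derive1_powR (e - 1) x0.
- split.
  + by move=> x; rewrite in_itv/= => /andP[ax _]; have [] := dF x (lt_trans a0 ax).
  + by apply: cvg_at_right_filter; exact: cF.
  + by apply: cvg_at_left_filter; apply: cF; exact: lt_trans ab.
- move=> x; rewrite in_itv/= => /andP[ax _].
  by rewrite derive1E; have [_ ->] := dF x (lt_trans a0 ax).
Qed.

(** The integrand may blow up at [0], so the integral is a monotone limit over compact intervals. It
    is used for finiteness only, which an upper bound gives. *)
Lemma integral_powR0_le (e x : R) : (0 < e)%R -> (0 < x)%R ->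
  \int[mu]_(q in `]0%R, x]) (q `^ (e - 1))%:E <= (x `^ e / e)%:E.
Proof.
move=> e0 x0.
(* With [n.+2] the left endpoint lies strictly below [x] already for [n = 0], as [integral_powR]
   requires. *)
have -> : `]0%R, x]%classic = \bigcup_n `[x / n.+2%:R, x]%classic%R.
  apply/seteqP; split => q /=.
    rewrite in_itv/= => /andP[q0 qx]; exists (Num.truncn (x / q)) => //=.
    rewrite in_itv/= qx andbT ler_pdivrMr// mulrC -ler_pdivrMr//.
    by rewrite (le_trans (ltW (truncnS_gt _)))// ler_nat.
  case=> n _ /=; rewrite !in_itv/= => /andP[xq ->]; rewrite andbT.
  by apply: lt_le_trans xq; rewrite divr_gt0.
have cv := @ge0_nondecreasing_set_cvg_integral _ (measurableTypeR R) R (fun n => `[x / n.+2%:R, x]%classic%R)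
  (fun q => (q `^ (e - 1))%:E) mu.
have {}cv : \int[mu]_(q in `[(x / n.+2%:R)%R, x]) (q `^ (e - 1))%:E @[n --> \oo] -->
    \int[mu]_(q in \bigcup_n `[(x / n.+2%:R)%R, x]%classic) (q `^ (e - 1))%:E.
  apply: cv.
  - move=> m n mn; rewrite subsetEset => q /=; rewrite !in_itv/= => /andP[mq ->].
    rewrite andbT; apply: le_trans mq; rewrite ler_pM2l// lef_pV2 ?posrE//.
    by rewrite ler_nat !ltnS.
  - by move=> n; exact: measurable_itv.
  - move=> n; apply: (measurableT_comp (f := EFin)) => //.
    by apply: measurable_funTS; exact: measurable_powR.
  - by move=> n q _; rewrite lee_fin powR_ge0.
rewrite -(cvg_lim _ cv)//; apply: lime_le; first exact: cvgP cv.
apply: nearW => n; rewrite integral_powR ?divr_gt0//; last first.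
  by rewrite ltr_pdivrMr// ltr_pMr// ltr1n.
by rewrite lee_fin ler_pM2r ?invr_gt0// lerBlDr lerDl powR_ge0.
Qed.

(** The substitution [q -> x q] reduces every [x > 0] to [1], so [W] is the integral up to [1]; what
    remains is that it is positive and finite. *)
Lemma integral_chi_density (d : nat) : (0 < d)%N ->
  exists2 W : R, (0 < W)%R & forall x : R,
    \int[mu]_(q in `]-oo, x[) (chi_density d q)%:E =
    (if (0 < x)%R then W * x `^ (d%:R / 2) else 0)%R%:E.
Proof.
move=> d0; have e0 : (0 < d%:R / 2 :> R)%R by rewrite divr_gt0// ltr0n.
set e := (d%:R / 2)%R in e0 *.
have w0 q : 0 <= (chi_density d q)%:E by rewrite lee_fin chi_density_ge0.
have mw D : measurable_fun D (fun q => (chi_density d q)%:E).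
  by apply: (measurableT_comp (f := EFin)) => //; apply: measurable_funTS; exact: measurable_chi_density.
pose J := \int[mu]_(q in `]-oo, 1%R[) (chi_density d q)%:E.
have J0 : 0 <= J by exact: integral_ge0.
have Jfin : J < +oo.
  apply: (@le_lt_trans _ _ (\int[mu]_(q in `]0%R, 1%R]) (q `^ (e - 1))%:E)); last first.
    by apply: le_lt_trans (integral_powR0_le e0 ltr01) _; rewrite ltry.
  rewrite /J integral_mkcond [leRHS]integral_mkcond; apply: le_integral_ge0 => q.
    by rewrite patchE; case: ifP.
  rewrite !patchE; case: ifPn => [|_]; last by case: ifP => // _; rewrite lee_fin powR_ge0.
  rewrite inE/= in_itv/= => q1; case: ifPn.
    by rewrite inE/= in_itv/= => /andP[q0 _]; rewrite /chi_density q0.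
  rewrite notin_setE/= in_itv/= ltW// andbT => /negP q0.
  by rewrite /chi_density (negbTE q0).
have Jpos : 0 < J.
  apply: (@lt_le_trans _ _ (\int[mu]_(q in `[(2^-1)%R, (3 / 4)%R]) (q `^ (e - 1))%:E)).
    rewrite integral_powR//; last by lra.
    rewrite lte_fin divr_gt0// subr_gt0 gt0_ltr_powR ?nnegrE//; lra.
  rewrite /J integral_mkcond [leRHS]integral_mkcond; apply: le_integral_ge0 => q.
    by rewrite patchE; case: ifP => // _; rewrite lee_fin powR_ge0.
  rewrite !patchE; case: ifPn => [|_]; last by case: ifP.
  rewrite inE/= in_itv/= => /andP[q1 q2]; rewrite mem_set/=; last by rewrite in_itv/=; lra.
  rewrite /chi_density ifT//; lra.
have JE : J = (fine J)%:E by rewrite fineK// ge0_fin_numE.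
exists (fine J); first by rewrite fine_gt0// Jpos Jfin.
move=> x; case: ifPn => x0; last first.
  rewrite integral0_eq// => q /=; rewrite in_itv/= => qx.
  rewrite /chi_density ifF//; apply/negbTE; rewrite -leNgt.
  by rewrite ltNge negbK in x0; exact: le_trans (ltW qx) x0.
rewrite EFinM -JE /J integral_mkcond [in RHS]integral_mkcond.
rewrite (ge0_integral_affine (a := x) 0%R) ?gt_eqF//; first last.
- by move=> q; rewrite patchE; case: ifP.
- by apply/(measurable_restrictT _ _).1 => //; exact: mw.
rewrite gtr0_norm//.
have xe : (x `^ e = x * x `^ (e - 1))%R by rewrite mulr_powRB1// ltW.
rewrite xe [in RHS]muleC EFinM -muleA; congr (_ * _).
rewrite -ge0_integralZl_EFin ?powR_ge0//; first last.
- by apply/(measurable_restrictT _ _).1 => //; exact: mw.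
- by move=> q _; rewrite patchE; case: ifP.
apply: eq_integral => q _; rewrite addr0 !patchE.
have -> : (x * q)%R \in `]-oo, x[%classic = (q \in `]-oo, 1%R[%classic).
  by rewrite !mem_setE !in_itv/= gtr_pMr.
case: ifP => _; last by rewrite mule0.
by rewrite chi_densityM// -EFinM.
Qed.

End one_dimensional.

(** * Radial integrals and integrals over the sphere *)

Section radial_integrals.
Local Open Scope ereal_scope.
Context {R : realType}.
Notation mu := (@lebesgue_measure R).

(** This is the image under [rho] of the measure with density [f]; it allows laws of functions to be
    compared as measures. *)
Lemma density_measure d d' (T : measurableType d) (T' : measurableType d')
    (m : {measure set T -> \bar R}) (f : T -> \bar R) (rho : T -> T') :
  measurable_fun setT f -> (forall x, 0 <= f x) -> measurable_fun setT rho ->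
  exists m' : {measure set T' -> \bar R},
    forall A, m' A = \int[m]_(x in rho @^-1` A) f x.
Proof.
move=> mf f0 mrho; pose F (A : set T') := \int[m]_(x in rho @^-1` A) f x.
have F0 : F set0 = 0 by rewrite /F preimage_set0 integral_set0.
have Fge0 A : 0 <= F A by exact: integral_ge0.
have Fsa : semi_sigma_additive F.
  move=> G mG tG mUG; rewrite /F; apply: cvg_toP.
    apply: ereal_nondecreasing_is_cvgn => i j ij.
    by apply: lee_sum_nneg_natr => // k _ _; exact: Fge0.
  rewrite preimage_bigcup ge0_integral_bigcup//=.
  - by move=> k; rewrite -[_ @^-1` _]setTI; exact: mrho.
  - exact: measurable_funTS.
  - move/trivIsetP: tG => tG; apply/trivIsetP => i j _ _ ij.
    by rewrite -preimage_setI tG// preimage_set0.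
by exists (HB.pack_for {measure set T' -> \bar R} F (isMeasure.Build _ _ _ F F0 Fge0 Fsa)).
Qed.

Lemma integral_if_set d (T : measurableType d) (m : {measure set T -> \bar R})
    (b : T -> bool) (f : T -> \bar R) :
  \int[m]_x ((if b x then 1 else 0) * f x) = \int[m]_(x in [set x | b x]) f x.
Proof.
rewrite [RHS]integral_mkcond; apply: eq_integral => x _; rewrite patchE.
case: (boolP (b x)) => bx; first by rewrite mul1e mem_set.
by rewrite mul0e memNset//; exact/negP.
Qed.

Lemma tdot_scale d (r : R) (t : d.-tuple R) :
  tdot (tvec (r *: rv_of_tuple t)) (tvec (r *: rv_of_tuple t)) = (r ^+ 2 * tdot t t)%R.
Proof.
rewrite /tdot mulr_sumr; apply: eq_bigr => i _; rewrite !tnth_mktuple !mxE; ring.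
Qed.

(** Scaling reduces to the unit ball, which contains one cube and lies in another; this makes [V]
    positive and finite. *)
Lemma lebI_ball (d : nat) : exists2 V : R, (0 < V)%R & forall x : R,
  lebI (fun t : d.-tuple R => if (tdot t t < x)%R then 1 else 0) =
  (if (0 < x)%R then V * x `^ (d%:R / 2) else 0)%R%:E.
Proof.
have ind0 (b : bool) : 0 <= (if b then 1 else 0 : \bar R) by case: b.
have mB x : measurable_fun setT (fun t : d.-tuple R => (if (tdot t t < x)%R then 1 else 0 : \bar R)).
  by apply: measurable_fun_ifT => //; apply: measurable_fun_ltr => //; exact: measurable_tsq.
set J := lebI (fun t : d.-tuple R => if (tdot t t < 1)%R then 1 else 0).
pose o : d.-tuple R := [tuple 0%R | i < d].
have Jfin : J < +oo.
  apply: (@le_lt_trans _ _ (lebI (fun t : d.-tuple R => (\1_(box o 1%R) t)%:E))); last first.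
    by rewrite lebI_box// ltry.
  apply: le_lebI => t; first exact: ind0.
  case: ifPn => [t1|_]; last by rewrite lee_fin.
  rewrite indicE mem_set// => i; rewrite tnth_mktuple subr0.
  rewrite -(expr_le1 (n := 2))// real_normK ?num_real//.
  apply: le_trans (ltW t1); rewrite /tdot (bigD1 i)//= -expr2 lerDl.
  by apply: sumr_ge0 => j _; rewrite -expr2 sqr_ge0.
have Jpos : 0 < J.
  (* With [r = 1 / (d + 1)] one has [d r^2 < 1] for every [d], so this cube lies in the open unit
     ball. *)
  pose r : R := (d.+1%:R^-1)%R.
  have r0 : (0 < r)%R by rewrite invr_gt0.
  apply: (@lt_le_trans _ _ (lebI (fun t : d.-tuple R => (\1_(box o r) t)%:E))).
    by rewrite lebI_box// lte_fin exprn_gt0// mulrn_wgt0.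
  apply: le_lebI => t; first by rewrite lee_fin.
  rewrite indicE; case: (boolP (t \in _)) => [/set_mem bt|_]; last exact: ind0.
  rewrite ifT//; apply: (@le_lt_trans _ _ (\sum_(i < d) r ^+ 2)%R).
    apply: ler_sum => i _; have := bt i; rewrite tnth_mktuple subr0 => tr.
    by rewrite -expr2 -real_normK ?num_real// ler_sqr ?nnegrE// ltW.
  rewrite sumr_const card_ord -mulr_natr /r exprVn mulrC ltr_pdivrMr ?exprn_gt0// mul1r.
  by rewrite -natrX ltr_nat -[X in (X <= _)%N]expn1 leq_pexp2l.
have JE : J = (fine J)%:E by rewrite fineK// ge0_fin_numE// ltW.
exists (fine J); first by rewrite fine_gt0// Jpos Jfin.
move=> x; case: ifPn => x0; last first.
  rewrite (_ : (fun t => _) = fun=> 0).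
    elim: d {mB J o Jfin Jpos JE} => [//|d IHd] /=.
    by under eq_integral do rewrite IHd; rewrite integral0.
  apply/funext => t; rewrite ifF//; apply/negbTE; rewrite -leNgt.
  by apply: le_trans (tdot_ge0 t); rewrite leNgt.
rewrite EFinM -JE (lebI_scale (r := Num.sqrt x)) ?sqrtr_gt0//.
rewrite muleC; congr (_ * _%:E).
  apply: eq_lebI => t; rewrite tdot_scale sqr_sqrtr ?ltW// -[X in (_ < X)%R]mulr1.
  by rewrite ltr_pM2l.
rewrite -powR12_sqrt ?ltW// -powR_mulrn ?powR_ge0// -powRrM; congr (_ `^ _)%R; ring.
Qed.

(** Polar coordinates in the squared radius: the law of [tdot t t] and [V / W] times the chi density
    give equal mass to every open ray, hence coincide, and the layer cake formula passes from sets
    to functions. *)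
Lemma lebI_radial (d : nat) : (0 < d)%N -> exists2 C : R, (0 < C)%R &
  forall Psi : R -> \bar R, measurable_fun setT Psi -> (forall q, 0 <= Psi q) ->
  lebI (fun t : d.-tuple R => Psi (tdot t t)) =
  C%:E * \int[mu]_q (Psi q * (chi_density d q)%:E).
Proof.
move=> d0; have [W W0 WE] := @integral_chi_density R d d0.
have [V V0 VE] := lebI_ball d.
have C0 : (0 < V / W)%R by rewrite divr_gt0.
exists (V / W)%R => // Psi mPsi Psi0.
have [dd [T [nu [phi [mphi E]]]]] := @lebI_integral R d.
pose rho y : measurableTypeR R := tdot (phi y) (phi y).
have mrho : measurable_fun setT rho by exact: measurable_tsq.
have w0 q : 0 <= (chi_density d q)%:E :> \bar R by rewrite lee_fin chi_density_ge0.
have mw : measurable_fun setT (fun q : R => (chi_density d q)%:E).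
  by apply: (measurableT_comp (f := EFin)) => //; exact: measurable_chi_density.
have [m1 m1E] := density_measure nu (measurable_cst (1 : \bar R)) (fun=> lee01) mrho.
have mCw : measurable_fun setT (fun q : measurableTypeR R => (V / W)%:E * (chi_density d q)%:E).
  exact: measurable_funeM.
have [m2 m2E] : exists m2 : {measure set (measurableTypeR R) -> \bar R},
    forall A, m2 A = \int[mu]_(x in A) ((V / W)%:E * (chi_density d x)%:E).
  have := density_measure mu mCw _ (@measurable_id _ _ setT).
  by apply => q; rewrite mule_ge0// lee_fin ltW.
have m2E' A : measurable A -> m2 A = (V / W)%:E * \int[mu]_(x in A) (chi_density d x)%:E.
  move=> mA; rewrite m2E ge0_integralZl_EFin//; [exact: measurable_funTS|exact: ltW].
have ray x : m1 `]-oo, x[%classic = (if (0 < x)%R then V * x `^ (d%:R / 2) else 0)%R%:E.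
  rewrite m1E -VE E.
  - rewrite integral_mkcond; apply: eq_integral => y _; rewrite patchE.
    case: ifPn; first by rewrite inE/= in_itv/= => ->.
    by rewrite notin_setE/= in_itv/= => /negP/negbTE ->.
  - by apply: measurable_fun_ifT => //; apply: measurable_fun_ltr => //; exact: measurable_tsq.
  - by move=> t; case: ifP.
have m12 A : measurable A -> m1 A = m2 A.
  apply: measure_open_ray_unique => x; rewrite ray ?ltry//.
  rewrite m2E'// WE -EFinM; congr EFin; case: ifP => _; last by rewrite mulr0.
  by rewrite mulrA divfK// gt_eqF.
have mPr : measurable_fun setT (fun y => Psi (rho y)) by exact: measurableT_comp.
rewrite E//; last by apply: (measurableT_comp mPsi); exact: measurable_tsq.
rewrite -[LHS](_ : \int[nu]_y (Psi (rho y) * 1) = _); last by apply: eq_integral => y _; rewrite mule1.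
rewrite (ge0_integral_layer_cake nu (f := fun=> 1))// (ge0_integral_layer_cake mu)//.
have mL : measurable_fun setT (fun z : R * R =>
    (if (0 <= z.1)%R && (z.1%:E < Psi z.2) then 1 else 0) * (chi_density d z.2)%:E : \bar R).
  apply: emeasurable_funM; last by apply: (measurableT_comp mw); exact: measurable_snd.
  apply: (measurableT_comp (measurable_layer mPsi) (g := fun z : R * R => (z.2, z.1))).
  by apply: measurable_fun_pair; [exact: measurable_snd|exact: measurable_fst].
rewrite -ge0_integralZl_EFin//; [|by move=> s _; apply: integral_ge0 => q _; rewrite mule_ge0//; case: ifP| |exact: ltW]; last first.
  apply: (measurable_integral2 (g := fun s q =>
    (if (0 <= s)%R && (s%:E < Psi q) then 1 else 0) * (chi_density d q)%:E)) => //.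
  by move=> s q; rewrite mule_ge0//; case: ifP.
apply: eq_integral => s _; rewrite !integral_if_set.
set B := [set q | (0 <= s)%R && (s%:E < Psi q)].
have mB : measurable B.
  rewrite /B; case: (leP 0%R s) => _ /=.
    by rewrite -[X in measurable X]setTI; exact: emeasurable_fun_o_infty.
  by rewrite (_ : [set _ | _] = set0)//; apply/seteqP; split.
by rewrite -m2E'// -m12// m1E.
Qed.

Lemma chi_densityS d (q : R) : (0 < q)%R ->
  chi_density d.+1 q = (Num.sqrt q * q `^ (d%:R / 2 - 1))%R.
Proof.
move=> q0; rewrite /chi_density q0 -powR12_sqrt ?ltW// -powRD; last first.
  by apply/implyP => _; rewrite gt_eqF.
by congr (_ `^ _)%R; rewrite -natr1; ring.
Qed.

(** The substitution [s = sqrt q x] separates radius from direction. The Jacobian and the powers of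
    [q] from the density combine into the chi density one dimension higher. *)
Lemma integral_sphere_slice d (c q : R) (h : R -> \bar R) : (0 <= c)%R -> (0 < q)%R ->
  measurable_fun setT h -> (forall x, 0 <= h x) ->
  \int[mu]_s (h (`|c * s| / Num.sqrt q)%R * (chi_density d (q - s * s))%:E) =
  (chi_density d.+1 q)%:E *
  \int[mu]_x (h (c * `|x|)%R * (chi_density d (1 - x ^+ 2))%:E).
Proof.
move=> c0 q0 mh h0.
have w0 x : 0 <= (chi_density d x)%:E :> \bar R by rewrite lee_fin chi_density_ge0.
have sq0 : (0 < Num.sqrt q)%R by rewrite sqrtr_gt0.
have mn (e : R) : measurable_fun setT (fun x : R => e * `|x|)%R.
  by apply: measurable_funM => //; exact: measurableT_comp.
have E1 (x : R) : (`|c * (Num.sqrt q * x + 0)| / Num.sqrt q = c * `|x|)%R.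
  by rewrite addr0 !normrM (ger0_norm c0) (gtr0_norm sq0); field; rewrite gt_eqF.
have E2 (x : R) : (q - (Num.sqrt q * x + 0) * (Num.sqrt q * x + 0) = q * (1 - x ^+ 2))%R.
  by rewrite -[in RHS](sqr_sqrtr (ltW q0)) -[X in (X - _ = _)%R](sqr_sqrtr (ltW q0)); ring.
pose G (s : R) := h (`|c * s| / Num.sqrt q)%R * (chi_density d (q - s * s))%:E.
have G0 s : 0 <= G s by exact: mule_ge0.
have mG : measurable_fun setT G.
  apply: emeasurable_funM; last by apply: measurable_chi_density_comp; measurable_real.
  rewrite (_ : (fun s => _) = fun s : R => h ((c / Num.sqrt q) * `|s|)%R).
    exact: (measurableT_comp mh (mn _)).
  by apply/funext => s; rewrite normrM (ger0_norm c0); congr h; rewrite mulrAC.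
rewrite (@ge0_integral_affine _ (Num.sqrt q) 0%R G (lt0r_neq0 sq0) mG G0) /G.
rewrite (gtr0_norm sq0) (chi_densityS d q0) EFinM -muleA; congr (_ * _).
rewrite -ge0_integralZl_EFin; last exact: powR_ge0; first last.
- apply: emeasurable_funM; last by apply: measurable_chi_density_comp; measurable_real.
  exact: (measurableT_comp mh (mn _)).
- by move=> x _; apply: mule_ge0.
- exact: measurableT.
by apply: eq_integral => x _; rewrite E1 E2 (chi_densityM d _ q0) EFinM muleCA.
Qed.

(** Rotate [l] to the first axis, integrate the other [d] coordinates radially and take the total
    squared norm [q] as variable. Every slice at fixed [q] carries the same integral in [x], so
    integrating over [q] yields a constant. *)
Lemma lebI_sphere (d : nat) : (0 < d)%N -> exists2 K : R, (0 < K)%R &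
  forall (l : d.+1.-tuple R) (h : R -> \bar R),
  measurable_fun setT h -> (forall x, 0 <= h x) ->
  lebI (fun t : d.+1.-tuple R => if (0 < tdot t t <= 1)%R
    then h (`|tdot l t| / Num.sqrt (tdot t t))%R else 0) =
  K%:E * \int[mu]_x (h (Num.sqrt (tdot l l) * `|x|)%R * (chi_density d (1 - x ^+ 2))%:E).
Proof.
move=> d0; have [C C0 CE] := lebI_radial d0.
have [W W0 WE] := @integral_chi_density R d.+1 isT.
exists (C * W)%R; first exact: mulr_gt0.
move=> l h mh h0.
pose Phi (q r : R) : \bar R := if (0 < q <= 1)%R then h (`|r| / Num.sqrt q)%R else 0.
have Phi0 q r : 0 <= Phi q r by rewrite /Phi; case: ifP.
have mPhi : measurable_fun setT (fun z : R * R => Phi z.1 z.2).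
  (* The inverse square root is turned into a real power, for which measurability is at hand. *)
  rewrite (_ : (fun z => _) = fun z : R * R =>
      if (0 < z.1 <= 1)%R then h (`|z.2| * z.1 `^ (- 2^-1))%R else 0); last first.
    apply/funext => -[q r] /=; rewrite /Phi; case: ifP => // /andP[q0 _].
    by rewrite powRN powR12_sqrt// ltW.
  apply: measurable_fun_ifT => //.
    by apply: measurable_and; [apply: measurable_fun_ltr|apply: measurable_fun_ler].
  apply: (measurableT_comp mh); apply: measurable_funM.
    by apply: measurableT_comp => //; exact: measurable_snd.
  by apply: (measurableT_comp (measurable_powR _)); exact: measurable_fst.
rewrite -[LHS]/(lebI (fun t => Phi (tdot t t) (tdot l t))) (lebI_rotation _ mPhi)//.
set c := Num.sqrt (tdot l l).
have c0 : (0 <= c)%R by exact: sqrtr_ge0.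
have w0 x : 0 <= (chi_density d x)%:E :> \bar R by rewrite lee_fin chi_density_ge0.
have mw : measurable_fun setT (fun q : R => (chi_density d q)%:E).
  by apply: (measurableT_comp (f := EFin)) => //; exact: measurable_chi_density.
have mG : measurable_fun setT (fun z : R * R =>
    Phi z.2 (c * z.1)%R * (chi_density d (z.2 - z.1 * z.1))%:E).
  apply: emeasurable_funM; first by apply: (measurable_fun_comp2 mPhi); measurable_real.
  by apply: measurable_chi_density_comp; measurable_real.
have step (s : R) : lebI (fun t : d.-tuple R => Phi (s * s + tdot t t)%R (c * s)%R) =
    C%:E * \int[mu]_q (Phi q (c * s)%R * (chi_density d (q - s * s))%:E).
  have mP : measurable_fun setT (fun q : R => Phi (s * s + q)%R (c * s)%R).
    by apply: (measurable_fun_comp2 mPhi); measurable_real.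
  apply: etrans (CE _ mP (fun q => Phi0 _ _)) _.
  pose G q := Phi q (c * s)%R * (chi_density d (q - s * s))%:E.
  have G0 q : 0 <= G q by exact: mule_ge0.
  have mGs : measurable_fun setT G.
    apply: emeasurable_funM; first by apply: (measurable_fun_comp2 mPhi); measurable_real.
    by apply: measurable_chi_density_comp; measurable_real.
  (* Shifting by [s * s] turns the squared norm of the remaining coordinates into the total squared
     norm. *)
  have GE (q : R) : Phi (s * s + q)%R (c * s)%R * (chi_density d q)%:E = G (1 * q + s * s)%R.
    by rewrite /G mul1r addrK [(q + _)%R]addrC.
  rewrite (@ge0_integral_affine _ 1%R (s * s)%R G (oner_neq0 _) mGs G0) normr1 mul1e.
  by apply: (congr1 (fun z => C%:E * z)); apply: eq_integral => q _; exact: GE.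
transitivity (\int[mu]_s (C%:E * \int[mu]_q (Phi q (c * s)%R * (chi_density d (q - s * s))%:E))).
  apply: eq_integral => s _; apply: etrans (step s).
  by apply: (@eq_lebI R d) => t; rewrite tdot_cons theadE.
rewrite ge0_integralZl_EFin//; [|by move=> s _; apply: integral_ge0 => q _; rewrite mule_ge0| |exact: ltW]; last first.
  by apply: (measurable_integral2 mG) => s q; rewrite mule_ge0.
rewrite (tonelli mG); last by move=> s q; rewrite mule_ge0.
rewrite EFinM -muleA; congr (_ * _).
set I := \int[mu]_x (h _ * _).
have I0 : 0 <= I by apply: integral_ge0 => x _; rewrite mule_ge0.
(* The range [0 < q <= 1] may be enlarged to [q <= 1], since the density is [0] for [q <= 0]; [WE]
   then gives the integral over [q]. *)
transitivity (\int[mu]_q ((((fun q => (chi_density d.+1 q)%:E) \_ `]-oo, 1%R]) q) * I)).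
  apply: eq_integral => q _; rewrite patchE mem_setE in_itv/=.
  case: (boolP (0 < q <= 1)%R) => [/andP[q0 q1]|qN]; last first.
    rewrite integral0_eq; last by move=> s _; rewrite /Phi (negbTE qN) mul0e.
    case: ifPn => q1; last by rewrite mul0e.
    by rewrite /chi_density ifF ?mul0e//; apply/negbTE; move: qN; rewrite q1 andbT.
  rewrite q1 -integral_sphere_slice//; apply: eq_integral => s _.
  by rewrite /Phi q0 q1.
rewrite ge0_integralZr//.
- congr (_ * _); rewrite -integral_mkcond -integral_itv_bndo_bndc.
    by rewrite WE ltr01 powR1 mulr1.
  by apply: (measurableT_comp (f := EFin)) => //; apply: measurable_funTS; exact: measurable_chi_density.
- apply/(measurable_restrictT _ _).1 => //.
  by apply: (measurableT_comp (f := EFin)) => //; apply: measurable_funTS; exact: measurable_chi_density.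
- by move=> q _; rewrite patchE; case: ifP => // _; rewrite lee_fin chi_density_ge0.
Qed.

End radial_integrals.

(** * Euclidean norm and the arc cosine *)

Section euclidean.
Context {R : realType}.

Lemma dotv_comb m (a b : R) (x y : 'rV[R]_m) :
  dotv (a *: x - b *: y) (a *: x - b *: y) =
  a ^+ 2 * dotv x x - 2 * a * b * dotv x y + b ^+ 2 * dotv y y.
Proof.
rewrite /dotv !mulr_sumr -sumrB -big_split/=; apply: eq_bigr => i _.
rewrite !mxE; ring.
Qed.

Lemma dotv_cauchy m (x y : 'rV[R]_m) : dotv x y ^+ 2 <= dotv x x * dotv y y.
Proof.
have [/eqP|x0] := eqVneq (dotv x x) 0.
  by rewrite dotv_eq0 => /eqP ->; rewrite !dotvE !mul0mx mxE expr0n mul0r.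
have xx : 0 < dotv x x by rewrite lt_def x0 dotv_ge0.
have := dotv_ge0 (dotv x y *: x - dotv x x *: y).
rewrite dotv_comb.
have -> : dotv x y ^+ 2 * dotv x x - 2 * dotv x y * dotv x x * dotv x y +
  dotv x x ^+ 2 * dotv y y = dotv x x * (dotv x x * dotv y y - dotv x y ^+ 2) by ring.
by rewrite pmulr_rge0// subr_ge0.
Qed.

Lemma enorm_ge0 m (x : 'rV[R]_m) : 0 <= enorm x.
Proof. exact: sqrtr_ge0. Qed.

Lemma sqr_enorm m (x : 'rV[R]_m) : enorm x ^+ 2 = dotv x x.
Proof. by rewrite sqr_sqrtr// dotv_ge0. Qed.

Lemma abs_dotv_le m (x y : 'rV[R]_m) : `|dotv x y| <= enorm x * enorm y.
Proof.
rewrite -(@ler_pXn2r _ 2)// ?nnegrE ?mulr_ge0 ?enorm_ge0//.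
by rewrite exprMn !sqr_enorm real_normK ?num_real// dotv_cauchy.
Qed.

Lemma enorm_sub_le m (x y : 'rV[R]_m) : enorm (x - y) <= enorm x + enorm y.
Proof.
rewrite -(@ler_pXn2r _ 2)// ?nnegrE ?addr_ge0 ?enorm_ge0//.
rewrite sqrrD !sqr_enorm -{1 2}[x]scale1r -{1 2}[y]scale1r dotv_comb !expr1n !mul1r.
have := abs_dotv_le x y; rewrite ler_norml => /andP[h _]; lra.
Qed.

Lemma enorm_eq0 m (x : 'rV[R]_m) : (enorm x == 0) = (x == 0).
Proof. by rewrite -dotv_eq0 -sqr_enorm sqrf_eq0. Qed.

Lemma enormZ m (a : R) (x : 'rV[R]_m) : enorm (a *: x) = `|a| * enorm x.
Proof.
rewrite /enorm (_ : dotv _ _ = a ^+ 2 * dotv x x); last first.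
  by rewrite /dotv mulr_sumr; apply: eq_bigr => i _; rewrite !mxE; ring.
by rewrite sqrtrM ?sqr_ge0// sqrtr_sqr.
Qed.

Lemma abs_coord_le m (x : 'rV[R]_m) i : `|x 0 i| <= enorm x.
Proof.
rewrite -(@ler_pXn2r _ 2)// ?nnegrE ?enorm_ge0// sqr_enorm real_normK ?num_real//.
rewrite /dotv (bigD1 i)//= -expr2 lerDl; apply: sumr_ge0 => j _.
by rewrite -expr2 sqr_ge0.
Qed.

Lemma enorm_le_coord m (x : 'rV[R]_m) (e : R) : 0 <= e ->
  (forall i, `|x 0 i| <= e) -> enorm x <= m%:R * e.
Proof.
move=> e0 xe; rewrite -(@ler_pXn2r _ 2)// ?nnegrE ?enorm_ge0 ?mulr_ge0//.
rewrite sqr_enorm; apply: (@le_trans _ _ (\sum_(i < m) e ^+ 2)).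
  apply: ler_sum => i _; rewrite -expr2 -real_normK ?num_real//.
  by rewrite ler_pXn2r ?nnegrE.
rewrite sumr_const card_ord -[leLHS]mulr_natl exprMn ler_wpM2r ?sqr_ge0//.
rewrite -natrX ler_nat; case: m {x xe} => // m.
by rewrite -{1}(expn1 m.+1) leq_pexp2l.
Qed.

Lemma dotv_npole n (x : 'rV[R]_n.+1) : dotv x (npole R n) = x 0 ord_max.
Proof.
rewrite /dotv (bigD1 ord_max)//= big1 ?addr0 => [|i /negbTE i0].
  by rewrite !mxE eqxx mulr1.
by rewrite !mxE i0 mulr0.
Qed.

Lemma dotv_rv_of_tuple m (t : m.-tuple R) : dotv (rv_of_tuple t) (rv_of_tuple t) = tdot t t.
Proof. by rewrite dotv_tvec rv_of_tupleK. Qed.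

Lemma ler_acos (x y : R) : -1 <= x <= 1 -> -1 <= y <= 1 -> x <= y -> acos y <= acos x.
Proof.
move=> x1 y1 xy; rewrite leNgt; apply/negP => lt.
have := @ltr_cos R (acos x) (acos y).
rewrite !in_itv/= !acos_ge0// !acos_lepi// !acosK ?in_itv//= lt => /(_ isT isT).
by rewrite ltNge xy.
Qed.

End euclidean.

(** * One-dimensional formulas for [muS], [dist0] and [Rk] *)

Section spherical_formulas.
Context {R : realType}.
Notation mu := (@lebesgue_measure R).

(** With [x] the cosine of the distance to the pole, the factors are the sine weight, the cosine
    weight and the density of the last coordinate on the unit sphere. *)
Definition profile (n : nat) (a1 a2 x : R) : R :=
  Num.sqrt (1 - x ^+ 2) `^ a1 * `|x| `^ a2 * chi_density n (1 - x ^+ 2).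

(** This is [lebI_sphere] for the linear form given by the pole. Coordinates of unit vectors lie in
    [[0, 1]] in absolute value, so only the part of [S] in that interval counts. *)
Lemma muS_evenrad n : (0 < n)%N -> exists2 K : R, 0 < K & forall a1 a2 (S : set R),
  measurable (S `&` `[0, 1]) ->
  (muS a1 a2 [set x : 'rV[R]_n.+1 | S `|x 0 ord_max|%R] =
   K%:E * \int[mu]_x (\1_(S `&` `[0, 1]%classic) `|x|%R * profile n a1 a2 x)%:E)%E.
Proof.
move=> n0; have [K K0 KE] := @lebI_sphere R n n0.
exists (n.+1%:R * K); first by rewrite mulr_gt0.
move=> a1 a2 S mS.
pose h (v : R) : R := \1_(S `&` `[0, 1]%classic) v * (Num.sqrt (1 - v ^+ 2) `^ a1 * `|v| `^ a2).
have h0 v : 0 <= h v by rewrite !mulr_ge0// powR_ge0.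
have mh : measurable_fun setT (EFin \o h).
  apply: measurableT_comp => //; apply: measurable_funM; first exact: measurable_indic.
  apply: measurable_funM.
    have msq : measurable_fun setT (fun x : R => Num.sqrt x).
      exact: continuous_measurable_fun (@sqrt_continuous R).
    apply: (measurableT_comp (measurable_powR _)); apply: (measurableT_comp msq).
    by measurable_real.
  by apply: (measurableT_comp (measurable_powR _)).
pose l : n.+1.-tuple R := tvec (npole R n).
have ll : tdot l l = 1 by rewrite /l -dotv_tvec dotv_npole mxE eqxx.
have lt t : tdot l t = tnth t ord_max.
  by rewrite -[t in LHS]rv_of_tupleK /l /tdot (eq_bigr (fun i => rv_of_tuple t 0 i * npole R n 0 i));
    [rewrite -/(dotv _ _) dotv_npole mxE|move=> i _; rewrite !tnth_mktuple mulrC].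
rewrite /muS /sphInt /intRn EFinM -muleA; congr (_ * _)%E.
transitivity (lebI (fun t : n.+1.-tuple R => if 0 < tdot t t <= 1
    then (EFin \o h) (`|tdot l t| / Num.sqrt (tdot t t)) else 0%E)); last first.
  rewrite KE// ?ll ?sqrtr1; congr (_ * _)%E; apply: eq_integral => x _.
  rewrite /= -EFinM mul1r /h /profile; congr EFin.
  by rewrite real_normK ?num_real// normr_id !mulrA.
apply: eq_lebI => t /=; set x := rv_of_tuple t.
have xx : dotv x x = tdot t t by rewrite dotv_rv_of_tuple.
have -> : (0 < enorm x) && (enorm x <= 1) = (0 < tdot t t <= 1).
  rewrite /enorm xx sqrtr_gt0; case: (ltP 0 (tdot t t)) => //= t0.
  by rewrite -[X in _ <= X]sqrtr1 ler_sqrt.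
case: ifP => // /andP[t0 t1].
have nx : 0 < enorm x by rewrite /enorm xx sqrtr_gt0.
rewrite lt -xx -/(enorm x); congr EFin.
set u := (enorm x)^-1 *: x.
have ue : enorm u = 1 by rewrite enormZ gtr0_norm ?invr_gt0// mulVf// gt_eqF.
have ul : `|u 0 ord_max| = `|tnth t ord_max| / enorm x.
  by rewrite !mxE normrM gtr0_norm ?invr_gt0// mulrC.
have u1 : -1 <= u 0 ord_max <= 1 by rewrite -ler_norml -ue abs_coord_le.
rewrite -ul /h /wS /sdist dotv_npole sin_acos// acosK ?in_itv//= normr_id.
rewrite real_normK ?num_real//; congr (_ * _).
rewrite !indicE; congr (nat_of_bool _)%:R; apply/idP/idP; rewrite !inE/= in_itv/=; last by case.
by move=> Su; split => //; rewrite normr_ge0 -ue abs_coord_le.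
Qed.

(** [acos] is decreasing and the largest last coordinate is attained, so the infimum in [dist0] is a
    minimum. *)
Lemma dist0_max k n (A : 'M[R]_(k.+1, n.+1)) (c : R) : 0 <= c ->
  (forall y, `|(y *m A) 0 ord_max| <= c * enorm (y *m A)) ->
  (exists2 y, enorm (y *m A) = 1 & (y *m A) 0 ord_max = c) ->
  c <= 1 /\ dist0 A = acos c.
Proof.
move=> c0 ub [y y1 yc].
have c1 : c <= 1 by rewrite -yc -y1; apply: le_trans (ler_norm _) (abs_coord_le _ _).
have c11 : -1 <= c <= 1 by rewrite c1 andbT; apply: le_trans c0; rewrite oppr_le0.
split => //; rewrite /dist0.
set S := [set _ | _ in _].
have Sc : S (acos c).
  exists (y *m A); first by split => //; exists y.
  by rewrite /sdist dotv_npole yc.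
have lbS : lbound S (acos c).
  move=> _ [x [+ [z xz]] <-]; rewrite xz /sdist dotv_npole => x1; apply: ler_acos => //.
    by rewrite -ler_norml -x1 abs_coord_le.
  by apply: le_trans (ler_norm _) _; apply: le_trans (ub z) _; rewrite x1 mulr1.
apply/eqP; rewrite eq_le; apply/andP; split.
  by apply: ge_inf => //; exists (acos c).
by apply: lb_le_inf => //; exists (acos c).
Qed.

(** In orthonormal coordinates of the plane the last coordinate is a linear form, and [c] is its
    norm. The Jacobian of the change of basis cancels the Gram determinant, which leaves a constant
    depending on [k] alone. *)
Lemma Rk_evenrad k : (0 < k)%N -> exists2 K : R, 0 < K &
  forall n (A : 'M[R]_(k.+1, n.+1)), row_free A -> exists c : R,
  [/\ 0 <= c, forall y, `|(y *m A) 0 ord_max| <= c * enorm (y *m A),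
      exists2 y, enorm (y *m A) = 1 & (y *m A) 0 ord_max = c
    & forall F : R -> R, measurable_fun (`[0, 1]%classic : set R) F -> (forall x, 0 <= F x) ->
      (Rk A (evenrad F) =
       K%:E * \int[mu]_x (F (c * `|x|)%R * chi_density k (1 - x ^+ 2))%:E)%E].
Proof.
move=> k0; have [K K0 KE] := @lebI_sphere R k k0.
exists (k.+1%:R * K); first by rewrite mulr_gt0.
move=> n A Afree; have [B [Bo Bl]] := lebI_orthonormalise Afree.
set Q := B *m A in Bo.
have dB : \det B ^+ 2 * \det (A *m A^T) = 1.
  rewrite -(det1 R k.+1) -Bo /Q trmx_mul !mulmxA -(mulmxA B A) !det_mulmx det_tr; ring.
have detB : \det B != 0.
  by apply/eqP => d0; move/eqP: dB; rewrite d0 expr0n mul0r eq_sym oner_eq0.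
have Bu : B \in unitmx by rewrite unitmxE unitfE.
have QE (z : 'rV_k.+1) : enorm (z *m Q) = enorm z.
  by rewrite /enorm !dotvE trmx_mul mulmxA -(mulmxA z) Bo mulmx1.
pose l : 'rV[R]_k.+1 := \row_i Q i ord_max.
have lE (z : 'rV_k.+1) : (z *m Q) 0 ord_max = dotv l z.
  by rewrite mxE; apply: eq_bigr => i _; rewrite [l _ _]mxE mulrC.
(* The maximum is attained at the normalised vector [l], or at any unit vector if [l = 0]. *)
have att : exists2 y, enorm (y *m A) = 1 & (y *m A) 0 ord_max = enorm l.
  have [l0|l0] := eqVneq l 0.
    exists (delta_mx 0 0 *m B); rewrite -mulmxA -/Q ?QE ?lE ?l0.
      rewrite /enorm dotvE trmx_delta mul_delta_mx mxE !eqxx sqrtr1//.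
    by rewrite /enorm !dotvE !mul0mx mxE sqrtr0.
  have nl : 0 < enorm l by rewrite lt_def enorm_eq0 l0 enorm_ge0.
  exists ((enorm l)^-1 *: l *m B); rewrite -mulmxA -/Q ?QE ?lE.
    by rewrite enormZ gtr0_norm ?invr_gt0// mulVf// gt_eqF.
  rewrite (_ : dotv _ _ = (enorm l)^-1 * dotv l l); last first.
    by rewrite /dotv mulr_sumr; apply: eq_bigr => i _; rewrite !mxE; ring.
  by rewrite -sqr_enorm expr2 mulrA mulVf ?mul1r// gt_eqF.
have l1 : enorm l <= 1.
  by have [y y1 <-] := att; rewrite -y1; apply: le_trans (ler_norm _) (abs_coord_le _ _).
exists (enorm l); split=> //.
- exact: enorm_ge0.
- move=> y; have -> : y *m A = (y *m invmx B) *m Q by rewrite /Q mulmxA mulmxKV.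
  by rewrite lE QE abs_dotv_le.
move=> F mF F0.
(* [F] is measurable on [[0, 1]] only; its extension by zero is measurable everywhere and agrees
   with [F] wherever it is evaluated with nonzero weight. *)
pose F' : R -> R := F \_ `[0, 1]%classic.
have F'0 x : 0 <= F' x by rewrite /F' patchE; case: ifP.
have mF' : measurable_fun setT F' by apply/(measurable_restrictT _ _).1.
have F'E x : 0 <= x <= 1 -> F' x = F x.
  by move=> x01; rewrite /F' patchE mem_set//= in_itv.
have mF'E : measurable_fun setT (EFin \o F') by exact: measurableT_comp.
pose g (t : k.+1.-tuple R) : \bar R :=
  let x := rv_of_tuple t *m A in
  if 0 < dotv x x <= 1 then (F' (`|x 0 ord_max| * dotv x x `^ (- 2^-1)))%:E else 0%E.
have g0 t : (0 <= g t)%E by rewrite /g/=; case: ifP => // _; rewrite lee_fin.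
have mg : measurable_fun setT g.
  have mi i : measurable_fun setT (fun t : k.+1.-tuple R => (rv_of_tuple t *m A) 0 i).
    by apply: (measurable_mulmx_entry (u := id)).
  have md : measurable_fun setT (fun t : k.+1.-tuple R =>
      dotv (rv_of_tuple t *m A) (rv_of_tuple t *m A)).
    by apply: measurable_sum => i; apply: measurable_funM.
  apply: measurable_fun_ifT => //.
    by apply: measurable_and; [apply: measurable_fun_ltr|apply: measurable_fun_ler].
  apply: (measurableT_comp mF'E); apply: measurable_funM.
    by apply: measurableT_comp => //; exact: mi.
  by apply: (measurableT_comp (measurable_powR _)).
have normE (q : R) : 0 < q -> (Num.sqrt q)^-1 = q `^ (- 2^-1).
  by move=> q0; rewrite powRN powR12_sqrt// ltW.
have ballE (q : R) : (0 < Num.sqrt q) && (Num.sqrt q <= 1) = (0 < q <= 1).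
  rewrite sqrtr_gt0; case: (ltP 0 q) => //= q0.
  by rewrite -[X in _ <= X]sqrtr1 ler_sqrt.
rewrite /Rk /intRn.
transitivity ((k.+1%:R * Num.sqrt (\det (A *m A^T)))%:E * lebI g)%E.
  congr (_ * _)%E; apply: eq_lebI => t /=; rewrite /g /=.
  set x := rv_of_tuple t *m A; rewrite {1 2}/enorm ballE; case: ifP => // /andP[x0 x1].
  have nx : 0 < enorm x by rewrite /enorm sqrtr_gt0.
  rewrite /evenrad mxE normrM gtr0_norm ?invr_gt0// mulrC {1}/enorm normE// F'E//.
  rewrite -normE// mulr_ge0 ?invr_ge0 ?sqrtr_ge0//= -/(enorm x).
  by rewrite ler_pdivrMr// mul1r abs_coord_le.
rewrite (Bl g mg g0) muleA -EFinM.
have -> : k.+1%:R * Num.sqrt (\det (A *m A^T)) * `|\det B| = k.+1%:R :> R.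
  rewrite -mulrA -[RHS]mulr1; congr (_ * _).
  by rewrite -(sqrtr_sqr (\det B)) mulrC -sqrtrM ?sqr_ge0// dB sqrtr1.
rewrite EFinM -muleA; congr (_ * _)%E.
transitivity (lebI (fun t : k.+1.-tuple R => if 0 < tdot t t <= 1
    then (EFin \o F') (`|tdot (tvec l) t| / Num.sqrt (tdot t t)) else 0%E)); last first.
  rewrite KE// -dotv_tvec -/(enorm l); congr (_ * _)%E; apply: eq_integral => x _.
  rewrite /= -EFinM; congr EFin; rewrite {1 2}/chi_density.
  case: ifPn => [x1|_]; last by rewrite !mulr0.
  have x1' : `|x| <= 1.
    by rewrite -(expr_le1 (n := 2))// real_normK ?num_real// ltW// -subr_gt0.
  by rewrite F'E// mulr_ge0 ?enorm_ge0//= mulr_ile1 ?enorm_ge0.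
apply: eq_lebI => t; rewrite /g /tmulmx tvecK -mulmxA -/Q.
have -> : dotv (rv_of_tuple t *m Q) (rv_of_tuple t *m Q) = tdot t t.
  by rewrite -sqr_enorm QE sqr_enorm dotv_rv_of_tuple.
case: ifP => // /andP[t0 t1]; rewrite /= -normE// lE.
by rewrite dotv_tvec rv_of_tupleK.
Qed.

End spherical_formulas.

(** * Planes at prescribed distance outside a negligible set *)

Section generic_planes.
Context {R : realType}.

(** Otherwise the whole box would lie in the negligible set, although its volume is positive. *)
Lemma ae_mx_box m1 m2 (P : 'M[R]_(m1, m2) -> Prop) (A0 : 'M[R]_(m1, m2)) (r : R) :
  ae_mx P -> 0 < r -> exists2 A : 'M[R]_(m1, m2), (forall i j, `|A i j - A0 i j| <= r) & P A.
Proof.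
move=> [N [mN [PN N0]]] r0; apply: contrapT => nex.
pose v : (m1 * m2).-tuple R := tvec (mxvec A0).
have bN : box v r `<=` N.
  move=> t bt; apply: PN => /= Pt; apply: nex; exists (vec_mx (rv_of_tuple t)) => // i j.
  have := bt (mxvec_index i j); rewrite tnth_mktuple mxvecE.
  by rewrite -[X in tnth X]rv_of_tupleK tnth_mktuple -{1}[rv_of_tuple t]vec_mxK mxvecE.
have : (lebI (fun t => (\1_(box v r) t)%:E) <= lebI (fun t => (\1_N t)%:E))%E.
  apply: le_lebI => t; first by rewrite lee_fin.
  rewrite lee_fin !indicE ler_nat; case: (boolP (t \in box v r)) => // /set_mem/bN tN.
  by rewrite mem_set.
by rewrite N0 lebI_box// lee_fin leNgt exprn_gt0// mulrn_wgt0.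
Qed.

(** The rows are the basis vectors [e_0, ..., e_(k-1)] and [s e_k + c e_n]; [k < n] keeps the last
    two indices apart. *)
Lemma exists_orthonormal_plane k n (c s : R) : (k < n)%N -> s ^+ 2 + c ^+ 2 = 1 ->
  exists2 A : 'M[R]_(k.+1, n.+1), A *m A^T = 1%:M &
    forall y : 'rV_k.+1, (y *m A) 0 ord_max = y 0 ord_max * c.
Proof.
move=> kn sc1; have kn1 : (k.+1 <= n.+1)%N by rewrite ltnS ltnW.
pose w (i : 'I_k.+1) : 'I_n.+1 := widen_ord kn1 i.
pose A : 'M[R]_(k.+1, n.+1) := \matrix_(i, j)
  (if i == ord_max then (j == w ord_max)%:R * s + (j == ord_max)%:R * c
   else (j == w i)%:R).
have wmax i : (w i == ord_max) = false.
  by rewrite -val_eqE/= ltn_eqF// (leq_ltn_trans _ kn)// -ltnS.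
have wE i j : (w i == w j) = (i == j) by rewrite -!val_eqE.
have sumd (a : 'I_n.+1) (g : 'I_n.+1 -> R) : \sum_l (l == a)%:R * g l = g a.
  rewrite (bigD1 a)//= big1 ?addr0 ?eqxx ?mul1r// => l /negbTE ->.
  by rewrite mul0r.
have rowE (i j : 'I_k.+1) : i != ord_max -> \sum_l A i l * A j l = (i == j)%:R.
  move=> imax; transitivity (A j (w i)).
    by rewrite -sumd; apply: eq_bigr => l _; rewrite [A i l]mxE (negbTE imax).
  rewrite mxE wmax !wE; case: (eqVneq j ord_max) => [->|//].
  by rewrite (negbTE imax) !mul0r addr0.
exists A => [|y]; last first.
  rewrite mxE (bigD1 ord_max)//= big1 ?addr0 => [|i imax].
    by rewrite mxE !eqxx eq_sym wmax mul0r add0r mul1r.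
  by rewrite mxE (negbTE imax) eq_sym wmax mulr0.
apply/matrixP => i j; rewrite !mxE (eq_bigr (fun l => A i l * A j l)); last first.
  by move=> l _; rewrite [A^T _ _]mxE.
have [imax|imax] := eqVneq i ord_max; last by rewrite rowE.
have [jmax|jmax] := eqVneq j ord_max; last first.
  rewrite (eq_bigr (fun l => A j l * A i l)) => [|l _]; last exact: mulrC.
  by rewrite rowE// imax eq_sym.
rewrite imax jmax eqxx.
transitivity (\sum_l (l == w ord_max)%:R * (A ord_max l * s) +
    \sum_l (l == ord_max)%:R * (A ord_max l * c)).
  by rewrite -big_split; apply: eq_bigr => l _; rewrite {1}mxE eqxx /=; ring.
rewrite !sumd !mxE !eqxx wmax [ord_max == _]eq_sym wmax.
have -> : (1 * s + 0 * c) * s + (0 * s + 1 * c) * c = s ^+ 2 + c ^+ 2 by ring.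
exact: sc1.
Qed.

(** Perturb an orthonormal frame whose [c] is the midpoint [c0]. An operator error [et] distorts
    lengths by a factor between [1 - et] and [1 + et] and moves the last coordinate by at most
    [et |y|], so [c] stays between [(c0 - et) / (1 + et)] and [(c0 + et) / (1 - et)]. *)
Lemma exists_generic_plane k n (c1 c2 : R) (P : 'M[R]_(k.+1, n.+1) -> Prop) :
  (k < n)%N -> 0 <= c1 -> c1 < c2 -> c2 <= 1 -> ae_mx P ->
  exists A, [/\ row_free A, P A & forall c, 0 <= c ->
    (forall y, `|(y *m A) 0 ord_max| <= c * enorm (y *m A)) ->
    (exists2 y, enorm (y *m A) = 1 & (y *m A) 0 ord_max = c) -> c1 < c < c2].
Proof.
move=> kn c10 c12 c21 aeP.
pose c0 := (c1 + c2) / 2; pose s0 := Num.sqrt (1 - c0 ^+ 2).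
have c01 : 0 <= c0 <= 1 by rewrite /c0; lra.
have s0E : s0 ^+ 2 = 1 - c0 ^+ 2.
  by rewrite sqr_sqrtr// subr_ge0 expr_le1//; case/andP: c01.
have sc : s0 ^+ 2 + c0 ^+ 2 = 1 by rewrite s0E subrK.
have [A0 A0o A0l] := exists_orthonormal_plane kn sc.
(* [c0] is at distance [4 et] from [c1] and from [c2]; as [c2 <= 1], this leaves room for the
   distortion. *)
pose et := (c2 - c1) / 8.
have et0 : 0 < et by rewrite /et; lra.
(* An entrywise error [r] has operator norm at most [(k+1) (n+1) r = et]. *)
pose r := et / (k.+1%:R * n.+1%:R).
have r0 : 0 < r by rewrite divr_gt0// mulr_gt0.
have [A AA0 PA] := ae_mx_box A0 aeP r0.
have A0n (y : 'rV_k.+1) : enorm (y *m A0) = enorm y.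
  by rewrite /enorm !dotvE trmx_mul mulmxA -(mulmxA y) A0o mulmx1.
have D (y : 'rV_k.+1) : enorm (y *m (A - A0)) <= et * enorm y.
  rewrite (_ : et * _ = n.+1%:R * (r * (k.+1%:R * enorm y))); last first.
    have : n.+1%:R != 0 :> R by rewrite pnatr_eq0.
    have : k.+1%:R != 0 :> R by rewrite pnatr_eq0.
    rewrite /r; move: (k.+1%:R : R) (n.+1%:R : R) (enorm y) => u v w u0 v0.
    by field; rewrite u0 v0.
  apply: enorm_le_coord => [|j]; first by apply: mulr_ge0; [exact: ltW|rewrite mulr_ge0 ?enorm_ge0].
  rewrite mxE; apply: le_trans (ler_norm_sum _ _ _) _.
  apply: (@le_trans _ _ (\sum_(i < k.+1) r * enorm y)).
    apply: ler_sum => i _; rewrite normrM mulrC ler_pM//; last exact: abs_coord_le.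
    by rewrite !mxE.
  by rewrite sumr_const card_ord -[leLHS]mulr_natl mulrCA lexx.
have AE (y : 'rV_k.+1) : y *m A = y *m A0 - (- (y *m (A - A0))).
  by rewrite opprK mulmxBr addrC subrK.
have A0E (y : 'rV_k.+1) : y *m A0 = y *m A - y *m (A - A0).
  by rewrite mulmxBr opprB addrC subrK.
have nN (x : 'rV[R]_n.+1) : enorm (- x) = enorm x by rewrite -scaleN1r enormZ normrN1 mul1r.
have Aup y : enorm (y *m A) <= (1 + et) * enorm y.
  by rewrite AE; apply: le_trans (enorm_sub_le _ _) _; rewrite nN A0n mulrDl mul1r lerD2l D.
have Alo y : (1 - et) * enorm y <= enorm (y *m A).
  rewrite mulrBl mul1r lerBlDr -[X in X <= _]A0n A0E.
  by apply: le_trans (enorm_sub_le _ _) _; rewrite lerD2l D.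
have Al y : `|(y *m A) 0 ord_max - y 0 ord_max * c0| <= et * enorm y.
  rewrite -A0l (_ : _ - _ = (y *m (A - A0)) 0 ord_max); last by rewrite mulmxBr !mxE.
  exact: le_trans (abs_coord_le _ _) (D y).
have et1 : et < 1 by rewrite /et; lra.
exists A; split => //.
  rewrite -kermx_eq0; apply/rowV0P => y /sub_kermxP yA0; apply/eqP.
  rewrite -enorm_eq0 eq_le enorm_ge0 andbT.
  have := Alo y; rewrite yA0 (_ : enorm 0 = 0); last by apply/eqP; rewrite enorm_eq0.
  by rewrite pmulr_rle0// subr_gt0.
move=> c cge0 ub [y y1 yc]; apply/andP; split.
  pose e : 'rV[R]_k.+1 := delta_mx 0 ord_max.
  have e1 : enorm e = 1 by rewrite /enorm dotvE trmx_delta mul_delta_mx mxE !eqxx sqrtr1.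
  have el : e 0 ord_max = 1 by rewrite mxE !eqxx.
  have := Al e; rewrite el e1 mul1r mulr1 ler_norml => /andP[h1 _].
  have := ub e; have := Aup e; rewrite e1 mulr1 => h2 h3.
  have h4 : c * enorm (e *m A) <= c * (1 + et) by rewrite ler_wpM2l.
  have h5 : c0 - et <= c * (1 + et).
    by apply: le_trans (le_trans h3 h4); apply: le_trans (ler_norm _); lra.
  rewrite -(ltr_pM2r (_ : 0 < 1 + et)); last by lra.
  apply: lt_le_trans h5; rewrite /c0 /et; nra.
have := Al y; have := Alo y; rewrite y1 yc => h1 h2.
have y0 : `|y 0 ord_max| <= enorm y by exact: abs_coord_le.
have h3 : c <= (c0 + et) * enorm y.
  move: h2 y0; rewrite !ler_norml => /andP[_ h2] /andP[_ y0].
  have : y 0 ord_max * c0 <= enorm y * c0 by rewrite ler_wpM2r//; case/andP: c01.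
  by move=> h4; rewrite mulrDl; lra.
have ny : 0 <= enorm y by exact: enorm_ge0.
rewrite -(ltr_pM2r (_ : 0 < 1 - et)); last by lra.
apply: (@le_lt_trans _ _ ((c0 + et) * ((1 - et) * enorm y))).
  by rewrite mulrCA mulrC ler_wpM2l//; lra.
apply: (@le_lt_trans _ _ (c0 + et)).
  rewrite -[leRHS]mulr1 ler_wpM2l//; case/andP: c01; lra.
rewrite /c0 /et; nra.
Qed.

End generic_planes.

Lemma le_poweR (R : realType) (x y : \bar R) (r : R) :
  0 <= r -> (0 <= x)%E -> (x <= y)%E -> (x `^ r <= y `^ r)%E.
Proof.
move=> r0 x0 xy; apply: gt0_ler_poweR => //; rewrite in_itv/= ?leey ?andbT//.
exact: le_trans xy.
Qed.

(** * Bounds for real powers on an interval *)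

Section powR_bounds.
Context {R : realType}.
Implicit Types l u q b : R.

(** The sign of [b] decides which endpoint dominates; the sum of both endpoint values covers either
    sign, so later arguments need no case distinction on exponents. *)
Lemma powR_ub l u q b : 0 < l -> l <= q -> q <= u -> q `^ b <= l `^ b + u `^ b.
Proof.
move=> l0 lq qu; have q0 : 0 < q by exact: lt_le_trans lq.
have u0 : 0 < u by exact: lt_le_trans qu.
have [b0|b0] := leP 0 b.
  apply: (@le_trans _ _ (u `^ b)); last by rewrite lerDr powR_ge0.
  by rewrite ge0_ler_powR// nnegrE ltW.
apply: (@le_trans _ _ (l `^ b)); last by rewrite lerDl powR_ge0.
rewrite -(opprK b) [X in X <= _]powRN [X in _ <= X]powRN lef_pV2 ?posrE ?powR_gt0//.
by rewrite ge0_ler_powR// ?nnegrE ?ltW// oppr_gt0.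
Qed.

Lemma powR_lb l u q b : 0 < l -> l <= q -> q <= u ->
  (l `^ (- b) + u `^ (- b))^-1 <= q `^ b.
Proof.
move=> l0 lq qu; have q0 : 0 < q by exact: lt_le_trans lq.
have u0 : 0 < u by exact: lt_le_trans qu.
have -> : q `^ b = (q `^ (- b))^-1 by rewrite powRN invrK.
rewrite lef_pV2 ?posrE; [exact: powR_ub| |exact: powR_gt0].
by rewrite addr_gt0 ?powR_gt0.
Qed.

(** Splits off the [-1]: the remaining exponent is nonnegative, so monotonicity applies whatever the
    sign of [d/2 - 1]. *)
Lemma chi_densityE d (x : R) : 0 < x -> chi_density d x = x `^ (d%:R / 2) / x.
Proof.
move=> x0; rewrite /chi_density x0 powRB; last by apply/implyP => _; rewrite gt_eqF.
by rewrite powRr1// ltW.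
Qed.

Lemma one_sub_sqr_bounds (v : R) : 0 < v -> v < 1 / 2 -> v <= 1 - (1 - v) ^+ 2 <= 2 * v.
Proof. by move=> v0 v1; apply/andP; split; nra. Qed.

Lemma chi_density_near_pole d (v : R) : 0 < v -> v < 1 / 2 ->
  chi_density d (1 - (1 - v) ^+ 2) <= 2 `^ (d%:R / 2) * chi_density d v.
Proof.
move=> v0 v1; have /andP[vq q2v] := one_sub_sqr_bounds v0 v1.
have q0 : 0 < 1 - (1 - v) ^+ 2 by exact: lt_le_trans vq.
rewrite !chi_densityE// mulrA -powRM ?(ltW v0)//.
apply: ler_pM; rewrite ?powR_ge0 ?invr_ge0 ?(ltW q0)//; last by rewrite lef_pV2.
by rewrite ge0_ler_powR ?divr_ge0// ?nnegrE ?mulr_ge0 ?(ltW v0) ?(ltW q0).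
Qed.

End powR_bounds.

(** * The restricted inequality with weights independent of the plane *)

Section core.
Context {R : realType}.
Notation mu := (@lebesgue_measure R).
Variables (k : nat) (p : R).
Hypotheses (k0 : (0 < k)%N) (p1 : 1 < p).

Let e : R := k%:R / 2.
Let e0 : 0 < e. Proof. by rewrite divr_gt0// ltr0n. Qed.

(** Up to powers of [1 - c^2] and [c], a lower bound for [profile] at [c x] that does not involve
    [c]; see [profile_scaled_lower]. *)
Definition core_weight (x : R) : R :=
  if 0 < 1 - x ^+ 2 then (1 - x ^+ 2) `^ (p * (k%:R / 2) - 1) * `|x| `^ (p - 1) else 0.

Lemma core_weight_ge0 x : 0 <= core_weight x.
Proof. by rewrite /core_weight; case: ifP => // _; rewrite mulr_ge0 ?powR_ge0. Qed.

Let msq : measurable_fun setT (fun x : R => 1 - x ^+ 2).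
Proof. by measurable_real. Qed.

Lemma measurable_core_weight : measurable_fun setT core_weight.
Proof.
apply: measurable_fun_ifT => //; first exact: measurable_fun_ltr.
apply: measurable_funM; first exact: (measurableT_comp (measurable_powR _) msq).
by apply: (measurableT_comp (measurable_powR _)).
Qed.

Lemma core_weight_factor x : 0 < 1 - x ^+ 2 ->
  core_weight x = chi_density k (1 - x ^+ 2) * ((1 - x ^+ 2) `^ e * `|x|) `^ (p - 1).
Proof.
move=> q0; rewrite /core_weight /chi_density q0 powRM ?powR_ge0// mulrA; congr (_ * _).
rewrite -powRrM -powRD; last by apply/implyP => _; rewrite gt_eqF.
congr (_ `^ _); rewrite -/e; ring.
Qed.

(** For [|x| <= 1/2] one has [1 - x^2 >= 3/4], so [(1 - x^2)^e |x| < y] forces [|x| < A y]. [B] is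
    the factor of [chi_density_near_pole]. *)
Let A : R := ((3 / 4) `^ e)^-1.
Let B : R := 2 `^ e.
Let A0 : 0 < A. Proof. by rewrite invr_gt0 powR_gt0. Qed.
Let B0 : 0 < B. Proof. by rewrite powR_gt0. Qed.

Let chi_below (z v : R) : R := if v < z then chi_density k v else 0.

(** Covers the set where [(1 - x^2)^e |x| < y] by an interval about [0], on whose part [|x| <= 1/2]
    the chi density is at most [4/3], and by one layer at each of [1] and [-1]. *)
Let majorant (y x : R) : R :=
  4 / 3 * (if `|x| < A * y then 1 else 0) +
  (B * chi_below ((2 * y) `^ e^-1) (1 - x) + B * chi_below ((2 * y) `^ e^-1) (1 + x)).

Let chi_below_ge0 z v : 0 <= chi_below z v.
Proof. by rewrite /chi_below; case: ifP => // _; exact: chi_density_ge0. Qed.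

Let measurable_chi_below z : measurable_fun setT (chi_below z).
Proof.
apply: measurable_fun_ifT => //; last exact: measurable_chi_density.
exact: measurable_fun_ltr.
Qed.

Lemma chi_density_le_majorant (x y : R) : 0 < y -> 0 < 1 - x ^+ 2 ->
  (1 - x ^+ 2) `^ e * `|x| < y -> chi_density k (1 - x ^+ 2) <= majorant y x.
Proof.
move=> y0 q0 qy; set q := 1 - x ^+ 2 in q0 qy *.
have qE : q = 1 - `|x| ^+ 2 by rewrite real_normK ?num_real.
have B1 u : 0 <= B * chi_below ((2 * y) `^ e^-1) u by rewrite mulr_ge0 ?chi_below_ge0 ?ltW.
have x0 : 0 <= `|x| by [].
have [x2|x2] := leP `|x| (1 / 2).
  have q34 : 3 / 4 <= q by rewrite qE; nra.
  have qle1 : q <= 1 by rewrite /q lerBlDr lerDl sqr_ge0.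
  have xA : `|x| < A * y.
    rewrite /A mulrC ltr_pdivlMr ?powR_gt0// mulrC; apply: le_lt_trans qy.
    by rewrite ler_wpM2r// ge0_ler_powR ?(ltW e0)// ?nnegrE ?(ltW q0)//; lra.
  rewrite /majorant xA mulr1; apply: (@le_trans _ _ (4 / 3)); last first.
    by rewrite lerDl addr_ge0.
  rewrite chi_densityE// ler_pdivrMr//.
  have qe1 : q `^ e <= 1.
    by rewrite -(powRr0 q) ger_powR ?q0// ltW.
  by apply: le_trans qe1 _; lra.
have x1 : `|x| < 1.
  by rewrite -(expr_lt1 (n := 2))// -subr_gt0 -qE.
have v0 : 0 < 1 - `|x| by rewrite subr_gt0.
have v1 : 1 - `|x| < 1 / 2 by lra.
have xx : 1 - (1 - `|x|) = `|x| by ring.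
have chiv : chi_density k q <= B * chi_below ((2 * y) `^ e^-1) (1 - `|x|).
  rewrite /chi_below ifT.
    have := chi_density_near_pole k v0 v1.
    by rewrite xx -qE.
  have /andP[vq _] := one_sub_sqr_bounds v0 v1.
  rewrite xx -qE in vq.
  (* Here [|x| > 1/2], so [q^e < 2 y]; this is the origin of the [2] in the width of the layers. *)
  have ve : (1 - `|x|) `^ e < 2 * y.
    have h1 : (1 - `|x|) `^ e <= q `^ e by apply: ge0_ler_powR; rewrite ?nnegrE ?(ltW e0) ?(ltW v0) ?(ltW q0).
    have h2 : 0 <= q `^ e by rewrite powR_ge0.
    nra.
  have -> : 1 - `|x| = ((1 - `|x|) `^ e) `^ e^-1.
    by rewrite -powRrM divff ?gt_eqF// powRr1 ?ltW.
  by rewrite gt0_ltr_powR ?invr_gt0// nnegrE ?powR_ge0 ?mulr_ge0 ?ltW.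
apply: le_trans chiv _; rewrite /majorant.
apply: le_trans (_ : _ <= B * chi_below ((2 * y) `^ e^-1) (1 - x) + B * chi_below ((2 * y) `^ e^-1) (1 + x)) _.
  case: (ger0P x) => _; first by rewrite lerDl.
  by rewrite opprK lerDr.
by rewrite lerDr mulr_ge0//; case: ifP.
Qed.

Let measurable_majorant y : measurable_fun setT (majorant y).
Proof.
apply: measurable_funD; [|apply: measurable_funD].
- apply: measurable_funM => //; apply: measurable_fun_ifT => //.
  by apply: measurable_fun_ltr.
- by apply: measurable_funM => //; apply: (measurableT_comp (measurable_chi_below _)); measurable_real.
- by apply: measurable_funM => //; apply: (measurableT_comp (measurable_chi_below _)); measurable_real.
Qed.

Let majorant_ge0 y x : 0 <= majorant y x.
Proof.
rewrite /majorant !addr_ge0// ?mulr_ge0 ?chi_below_ge0 ?(ltW B0)//.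
by case: ifP.
Qed.

(** The layer width [(2 y)^(1/e)] is the one for which the chi density has mass [2 W y], so the
    total is exactly linear in [y]. *)
Lemma integral_majorant : exists2 M : R, 0 < M & forall y, 0 < y ->
  (\int[mu]_x (majorant y x)%:E = (M * y)%:E)%E.
Proof.
have [W W0 WE] := @integral_chi_density R k k0.
exists (8 / 3 * A + 4 * B * W); first by rewrite addr_gt0// !mulr_gt0.
move=> y y0.
have z0 : 0 < (2 * y) `^ e^-1 by rewrite powR_gt0// mulr_gt0.
have Eint : (\int[mu]_x (chi_below ((2 * y) `^ e^-1) x)%:E = (W * (2 * y))%:E)%E.
  transitivity (\int[mu]_(q in `]-oo, ((2 * y) `^ e^-1)%R[) (chi_density k q)%:E)%E.
    rewrite [RHS]integral_mkcond; apply: eq_integral => x _.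
    by rewrite patchE mem_setE in_itv/= /chi_below; case: ifP.
  rewrite WE z0 -/e -powRrM mulVf; last by rewrite gt_eqF.
  by rewrite powRr1// mulr_ge0// ltW.
have mc (u : R -> R) : measurable_fun setT u ->
    measurable_fun setT (fun x => (chi_below ((2 * y) `^ e^-1) (u x))%:E).
  move=> mu; apply: (measurableT_comp (f := EFin)) => //.
  exact: (measurableT_comp (measurable_chi_below _) mu).
have Eminus : (\int[mu]_x (chi_below ((2 * y) `^ e^-1) (1 - x)%R)%:E = (W * (2 * y))%:E)%E.
  rewrite -Eint (@ge0_integral_affine _ (-1) 1 (fun x => (chi_below ((2 * y) `^ e^-1) x)%:E)).
  - rewrite normrN1 mul1e; apply: eq_integral => x _.
    by rewrite mulN1r addrC.
  - by rewrite oppr_eq0 oner_eq0.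
  - exact: (mc id).
  - by move=> x; rewrite lee_fin.
have Eplus : (\int[mu]_x (chi_below ((2 * y) `^ e^-1) (1 + x)%R)%:E = (W * (2 * y))%:E)%E.
  rewrite -Eint (@ge0_integral_affine _ 1 1 (fun x => (chi_below ((2 * y) `^ e^-1) x)%:E)).
  - rewrite normr1 mul1e; apply: eq_integral => x _.
    by rewrite mul1r addrC.
  - by rewrite oner_eq0.
  - exact: (mc id).
  - by move=> x; rewrite lee_fin.
have Eball : (\int[mu]_x (if (`|x| < A * y)%R then 1 else 0)%:E = (2 * A * y)%:E)%E.
  transitivity (\int[mu]_x (\1_(`]- (A * y), (A * y)[%classic : set R) x)%:E)%E.
    apply: eq_integral => x _; rewrite indicE mem_setE in_itv/= -ltr_norml.
    by case: ifP.
  rewrite integral_indic//= setIT lebesgue_measure_itv/= lte_fin ifT.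
    by rewrite -EFinB; congr EFin; ring.
  by have := mulr_gt0 A0 y0; lra.
have c1 : (0 <= 4 / 3 :> R) by lra.
transitivity ((4 / 3)%:E * \int[mu]_x (if (`|x| < A * y)%R then 1 else 0)%:E +
  (B%:E * \int[mu]_x (chi_below ((2 * y) `^ e^-1) (1 - x)%R)%:E +
   B%:E * \int[mu]_x (chi_below ((2 * y) `^ e^-1) (1 + x)%R)%:E))%E; last first.
  rewrite Eball Eminus Eplus -!EFinM -!EFinD; congr EFin; ring.
have mb : measurable_fun setT (fun x : R => (if `|x| < A * y then 1 else 0 : R)%:E).
  apply: (measurableT_comp (f := EFin)) => //; apply: measurable_fun_ifT => //.
  by apply: measurable_fun_ltr.
have mm : measurable_fun setT (fun x : R => (chi_below ((2 * y) `^ e^-1) (1 - x))%:E).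
  by apply: (mc (fun x => 1 - x)); measurable_real.
have mp : measurable_fun setT (fun x : R => (chi_below ((2 * y) `^ e^-1) (1 + x))%:E).
  by apply: (mc (fun x => 1 + x)); measurable_real.
have ib0 x : (0 <= (if (`|x| < A * y)%R then 1 else 0 : R)%:E)%E by rewrite lee_fin; case: ifP.
have cb0 z x : (0 <= (chi_below z x)%:E)%E by rewrite lee_fin.
rewrite -!ge0_integralZl_EFin ?(ltW B0)//.
rewrite -ge0_integralD//; first last.
- by apply: measurable_funeM.
- by move=> x _; rewrite mule_ge0// lee_fin ltW.
- by apply: measurable_funeM.
- by move=> x _; rewrite mule_ge0// lee_fin ltW.
rewrite -ge0_integralD//; first last.
- by apply: emeasurable_funD; apply: measurable_funeM.
- by move=> x _; rewrite adde_ge0// mule_ge0// lee_fin ltW.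
- by apply: measurable_funeM.
- by move=> x _; rewrite mule_ge0.
Qed.

(* Splitting according to whether [core_weight] is at least [y^(p-1)] times the
   density gives [L <= M y + y^(1-p) H] for every [y > 0]; take [y = H^(1/p)]. *)
Lemma core_inequality : exists2 C : R, 0 < C & forall d : R -> R,
  measurable_fun setT d -> (forall x, 0 <= d x <= 1) ->
  (\int[mu]_x (d x * chi_density k (1 - x ^+ 2))%:E <=
   C%:E * (\int[mu]_x (d x * core_weight x)%:E) `^ p^-1)%E.
Proof.
have [M M0 ME] := integral_majorant.
have p0 : 0 < p by exact: lt_trans p1.
exists (M + 1); first by rewrite addr_gt0.
move=> d md d01.
set H := (\int[mu]_x (d x * core_weight x)%:E)%E.
have dw0 x : (0 <= (d x * core_weight x)%:E)%E.
  by rewrite lee_fin mulr_ge0 ?core_weight_ge0//; case/andP: (d01 x).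
have mdw : measurable_fun setT (fun x => (d x * core_weight x)%:E).
  apply: (measurableT_comp (f := EFin)) => //; apply: measurable_funM => //.
  exact: measurable_core_weight.
have H0 : (0 <= H)%E by exact: integral_ge0.
set L := (X in (X <= _)%E).
have step y : 0 < y -> (L <= (M * y)%:E + (y `^ (1 - p))%:E * H)%E.
  move=> y0; rewrite /H -ge0_integralZl_EFin ?powR_ge0// -ME// -ge0_integralD//; first last.
  - exact: measurable_funeM.
  - by move=> x _; rewrite mule_ge0// lee_fin powR_ge0.
  - by apply: (measurableT_comp (f := EFin)) => //; exact: measurable_majorant.
  - by move=> x _; rewrite lee_fin.
  apply: le_integral_ge0 => x.
    by rewrite lee_fin mulr_ge0 ?chi_density_ge0//; case/andP: (d01 x).
  rewrite -EFinM -EFinD lee_fin; have /andP[d0 d1] := d01 x.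
  have [q0|q0] := ltP 0 (1 - x ^+ 2); last first.
    rewrite {1}/chi_density ltNge q0/= mulr0 addr_ge0// mulr_ge0 ?powR_ge0//.
    by rewrite mulr_ge0// core_weight_ge0.
  have g0 : 0 <= chi_density k (1 - x ^+ 2) by exact: chi_density_ge0.
  have [qy|qy] := ltP ((1 - x ^+ 2) `^ e * `|x|) y.
    apply: (@le_trans _ _ (majorant y x)).
      by apply: le_trans (chi_density_le_majorant y0 q0 qy); rewrite ler_piMl.
    by rewrite lerDl mulr_ge0 ?powR_ge0// mulr_ge0// core_weight_ge0.
  apply: (@le_trans _ _ (y `^ (1 - p) * (d x * core_weight x))); last by rewrite lerDr.
  rewrite core_weight_factor//.
  have -> : y `^ (1 - p) * (d x * (chi_density k (1 - x ^+ 2) * ((1 - x ^+ 2) `^ e * `|x|) `^ (p - 1))) =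
    d x * chi_density k (1 - x ^+ 2) * (y `^ (1 - p) * ((1 - x ^+ 2) `^ e * `|x|) `^ (p - 1)) by ring.
  rewrite ler_peMr ?mulr_ge0// -(opprB p 1) powRN mulrC ler_pdivlMr ?powR_gt0// mul1r.
  rewrite ge0_ler_powR// ?nnegrE ?subr_ge0 ?(ltW p1) ?(ltW y0)//.
  by rewrite mulr_ge0 ?powR_ge0.
have [Hy|Hfin] := eqVneq H +oo%E.
  by rewrite Hy poweRyr ?invr_eq0 ?gt_eqF// mulry gtr0_sg ?addr_gt0// mul1e leey.
have HE : H = (fine H)%:E by rewrite fineK// ge0_fin_numE// lt_neqAle Hfin leey.
rewrite HE poweR_EFin -EFinM.
(* For [H = 0] the choice [y = H^(1/p)] is not positive; [y] tends to [0] instead. *)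
have [h0|h0] := eqVneq (fine H) 0.
  rewrite h0 powR0 ?invr_eq0 ?gt_eqF// mulr0; apply/lee_addgt0Pr => y y0; rewrite add0e.
  have := step (y / M); rewrite divr_gt0// => /(_ isT).
  by rewrite HE h0 mule0 adde0 mulrC divfK ?gt_eqF.
have hp : 0 < fine H by rewrite lt_def h0 fine_ge0.
apply: le_trans (step (fine H `^ p^-1) _) _; first exact: powR_gt0.
rewrite HE -EFinM -EFinD lee_fin mulrDl mul1r lerD2l -powRrM.
rewrite -{2}(powRr1 (fine_ge0 H0)) -powRD; last by rewrite h0 implybT.
by rewrite le_eqVlt; apply/orP; left; apply/eqP; congr (_ `^ _); field; rewrite gt_eqF.
Qed.

End core.

(** * From the core inequality to a bound uniform in the plane *)

Section key_inequality.
Context {R : realType}.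
Notation mu := (@lebesgue_measure R).

(** [V = 1 - (c x)^2] dominates [1 - c^2] and [1 - x^2], so it may replace both, their exponents
    being nonnegative by [0 <= g1] and [2 <= (1 + a2) k]. Since [V <= 1], it then suffices that the
    total exponent is at least that of [profile], which is the other condition on [g1]. *)
Lemma profile_scaled_lower n k (a1 a2 g1 c x : R) :
  0 < a2 -> 0 <= g1 -> (a1 + n%:R) / (1 + a2) - k%:R <= g1 -> 2 <= (1 + a2) * k%:R ->
  0 < c -> c <= 1 ->
  (Num.sqrt (1 - c ^+ 2) `^ g1) `^ (1 + a2) * c `^ a2 * core_weight k (1 + a2) x <=
  profile n a1 a2 (c * x).
Proof.
move=> a20 g10 g1n pk c0 c1.
have p0 : 0 < 1 + a2 by lra.
have prof0 : 0 <= profile n a1 a2 (c * x).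
  by rewrite /profile !mulr_ge0 ?powR_ge0 ?chi_density_ge0.
rewrite /core_weight; case: ifPn => [q0|_]; last by rewrite mulr0.
set q := 1 - x ^+ 2 in q0 *; set V := 1 - (c * x) ^+ 2.
have c2 : c ^+ 2 <= 1 by rewrite expr_le1// ltW.
have s0 : 0 <= 1 - c ^+ 2 by rewrite subr_ge0.
have x2 : 0 <= x ^+ 2 by exact: sqr_ge0.
have c20 : 0 <= c ^+ 2 by exact: sqr_ge0.
have VE : V = 1 - c ^+ 2 * x ^+ 2 by rewrite /V exprMn.
have Vq : q <= V by rewrite VE /q; nra.
have Vs : 1 - c ^+ 2 <= V by rewrite VE; rewrite /q in q0; nra.
have V1 : V <= 1 by rewrite VE; nra.
have V0 : 0 < V by exact: lt_le_trans Vq.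
have sqrtV : Num.sqrt V `^ a1 = V `^ (a1 / 2).
  by rewrite -powR12_sqrt ?(ltW V0)// -powRrM; congr (_ `^ _); ring.
have sqrtc : (Num.sqrt (1 - c ^+ 2) `^ g1) `^ (1 + a2) = (1 - c ^+ 2) `^ (g1 * (1 + a2) / 2).
  by rewrite -powR12_sqrt// -!powRrM; congr (_ `^ _); ring.
have -> : profile n a1 a2 (c * x) =
    c `^ a2 * `|x| `^ a2 * V `^ ((a1 + n%:R) / 2 - 1).
  rewrite /profile -/V /chi_density V0 sqrtV normrM (gtr0_norm c0) powRM ?(ltW c0)//.
  rewrite mulrAC mulrC -powRD; last by apply/implyP => _; rewrite gt_eqF.
  by congr (_ * _ `^ _); ring.
have -> : 1 + a2 - 1 = a2 by ring.
rewrite sqrtc.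
have -> : (1 - c ^+ 2) `^ (g1 * (1 + a2) / 2) * c `^ a2 *
    (q `^ ((1 + a2) * (k%:R / 2) - 1) * `|x| `^ a2) =
  c `^ a2 * `|x| `^ a2 *
    ((1 - c ^+ 2) `^ (g1 * (1 + a2) / 2) * q `^ ((1 + a2) * (k%:R / 2) - 1)) by ring.
rewrite ler_wpM2l ?mulr_ge0 ?powR_ge0//.
apply: (@le_trans _ _ (V `^ (g1 * (1 + a2) / 2) * V `^ ((1 + a2) * (k%:R / 2) - 1))).
  apply: ler_pM; rewrite ?powR_ge0//.
    by rewrite ge0_ler_powR// ?nnegrE ?(ltW V0)// !mulr_ge0// ltW.
  by rewrite ge0_ler_powR// ?nnegrE ?(ltW V0) ?(ltW q0)//; lra.
rewrite -powRD; last by apply/implyP => _; rewrite gt_eqF.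
rewrite ger_powR ?V0//.
have : (a1 + n%:R) / (1 + a2) <= g1 + k%:R by lra.
rewrite ler_pdivrMr// => h; lra.
Qed.

Lemma measurable_profile n (a1 a2 : R) : measurable_fun setT (profile n a1 a2).
Proof.
have msq : measurable_fun setT (fun x : R => Num.sqrt x).
  exact: continuous_measurable_fun (@sqrt_continuous R).
have mq : measurable_fun setT (fun x : R => 1 - x ^+ 2) by measurable_real.
apply: measurable_funM; last exact: (measurableT_comp (measurable_chi_density n) mq).
apply: measurable_funM.
  exact: (measurableT_comp (measurable_powR _) (measurableT_comp msq mq)).
by apply: (measurableT_comp (measurable_powR _)).
Qed.

Lemma profile_ge0 n (a1 a2 x : R) : 0 <= profile n a1 a2 x.
Proof. by rewrite /profile !mulr_ge0 ?powR_ge0 ?chi_density_ge0. Qed.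

(** Substituting [c x] in the integral of [profile] yields [c c^a2 = c^(1+a2)], hence exactly one
    factor [c] after the root; the rest is [core_inequality] for the rescaled set. *)
Lemma key_inequality n k (a1 a2 g1 : R) : (0 < k)%N -> 0 < a2 -> 0 <= g1 ->
  (a1 + n%:R) / (1 + a2) - k%:R <= g1 -> 2 <= (1 + a2) * k%:R ->
  exists2 C : R, 0 < C & forall (c : R) (S : set R), 0 < c -> c <= 1 -> measurable S ->
  ((Num.sqrt (1 - c ^+ 2) `^ g1 * c)%:E *
     \int[mu]_x (\1_S (c * `|x|)%R * chi_density k (1 - x ^+ 2))%:E <=
   C%:E * (\int[mu]_x (\1_S `|x|%R * profile n a1 a2 x)%:E) `^ (1 + a2)^-1)%E.
Proof.
move=> k0 a20 g10 g1n pk.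
have p1 : 1 < 1 + a2 by lra.
have p0 : 0 < 1 + a2 by lra.
have [C C0 CE] := @core_inequality R k (1 + a2) k0 p1.
exists C => // c S c0 c1 mS.
pose d (x : R) : R := \1_S (c * `|x|).
have mcx : measurable_fun setT (fun x : R => c * `|x|) by apply: measurable_funM.
have mi : measurable_fun setT (\1_S : R -> R) by exact: measurable_indic.
have md : measurable_fun setT d by exact: (measurableT_comp mi mcx).
have d01 x : 0 <= d x <= 1 by rewrite /d indicE; case: (_ \in _); rewrite ?lexx ?ler01.
set s := Num.sqrt (1 - c ^+ 2) `^ g1.
have s0 : 0 <= s by exact: powR_ge0.
set H := (\int[mu]_x (d x * core_weight k (1 + a2) x)%:E)%E.
have H0 : (0 <= H)%E.
  by apply: integral_ge0 => x _; rewrite lee_fin mulr_ge0 ?core_weight_ge0.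
set I := (\int[mu]_x (\1_S `|x|%R * profile n a1 a2 x)%:E)%E.
have I0 : (0 <= I)%E by apply: integral_ge0 => x _; rewrite lee_fin mulr_ge0 ?profile_ge0.
have HI : (((s * c) `^ (1 + a2))%:E * H <= I)%E.
  pose G (x : R) := (\1_S `|x| * profile n a1 a2 x)%:E.
  have mG : measurable_fun setT G.
    apply: (measurableT_comp (f := EFin)) => //; apply: measurable_funM.
      by apply: (measurableT_comp mi).
    exact: measurable_profile.
  have G0 x : (0 <= G x)%E by rewrite lee_fin mulr_ge0 ?profile_ge0.
  rewrite /I (@ge0_integral_affine _ c 0 G (lt0r_neq0 c0) mG G0) gtr0_norm//.
  have -> : (s * c) `^ (1 + a2) = c * (s `^ (1 + a2) * c `^ a2).
    rewrite powRM ?(ltW c0)// mulrCA; congr (_ * _).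
    by rewrite -(mulr_powRB1 (ltW c0) p0); congr (_ * _ `^ _); ring.
  rewrite EFinM -muleA; apply: lee_wpmul2l; first by rewrite lee_fin ltW.
  rewrite /H -ge0_integralZl_EFin; last (by rewrite mulr_ge0 ?powR_ge0); first last.
  - apply: (measurableT_comp (f := EFin)) => //; apply: measurable_funM => //.
    exact: measurable_core_weight.
  - by move=> x _; rewrite lee_fin mulr_ge0 ?core_weight_ge0//; case/andP: (d01 x).
  - exact: measurableT.
  apply: le_integral_ge0 => x.
    by rewrite -EFinM lee_fin !mulr_ge0 ?powR_ge0 ?core_weight_ge0.
  rewrite -EFinM lee_fin addr0 normrM (gtr0_norm c0) mulrCA ler_wpM2l//.
  exact: profile_scaled_lower.
apply: (@le_trans _ _ ((s * c)%:E * (C%:E * H `^ (1 + a2)^-1))%E).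
  by apply: lee_wpmul2l; [rewrite lee_fin mulr_ge0// ltW|exact: CE].
rewrite muleCA lee_pmul2l ?lte_fin//.
have sc0 : 0 <= s * c by rewrite mulr_ge0// ltW.
have -> : (s * c)%:E = (((s * c) `^ (1 + a2))%:E `^ (1 + a2)^-1)%E.
  by rewrite poweR_EFin -powRrM divff ?gt_eqF// powRr1.
rewrite -poweRM ?lee_fin ?powR_ge0//.
by apply: le_poweR => //; rewrite ?mule_ge0 ?lee_fin ?powR_ge0 ?invr_ge0 ?(ltW p0).
Qed.

End key_inequality.

(** * Level sets, the Lorentz norm and the layer cake formula *)

Section level_sets.
Context {R : realType}.
Notation mu := (@lebesgue_measure R).
Implicit Types F : R -> R.

(** Cutting to [[0, 1]] gives joint measurability from that of [F] on [[0, 1]]; requiring [0 <= s]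
    makes negative levels empty, so integrals in [s] can run over the whole line. *)
Definition level F (s : R) : set R := [set v | [/\ 0 <= v <= 1, 0 <= s & s < `|F v|]].

Let restr F : R -> R := F \_ `[0, 1]%classic.

Lemma levelP F s v : (v \in level F s) = (0 <= s) && (s < `|restr F v|).
Proof.
apply/idP/idP => [/set_mem[v01 s0 sF]|/andP[s0 sF]].
  by rewrite s0 /restr patchE mem_set//= in_itv.
apply: mem_set; move: sF; rewrite /restr patchE; case: ifPn => [|_]; last first.
  by rewrite normr0 ltNge s0.
by rewrite inE/= in_itv/= => v01 sF.
Qed.

Let mrestr F : measurable_fun (`[0, 1]%classic : set R) F ->
  measurable_fun setT (fun v => `|restr F v|).
Proof.
move=> mF; have m1 : measurable_fun setT (restr F) by apply/(measurable_restrictT _ _).1.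
exact: measurableT_comp.
Qed.

Lemma indic_levelE F s v : \1_(level F s) v = (if (0 <= s) && (s < `|restr F v|) then 1 else 0 : R).
Proof. by rewrite indicE levelP; case: ifP. Qed.

Lemma measurable_indic_level F : measurable_fun (`[0, 1]%classic : set R) F ->
  measurable_fun setT (fun z : R * R => \1_(level F z.1) z.2 : R).
Proof.
move=> mF.
rewrite (_ : (fun z => _) = fun z : R * R => if (0 <= z.1) && (z.1 < `|restr F z.2|) then 1 else 0).
  apply: measurable_fun_ifT => //; apply: measurable_and.
    by apply: measurable_fun_ler.
  apply: measurable_fun_ltr => //.
  by apply: (measurableT_comp (mrestr mF)); exact: measurable_snd.
by apply/funext => z; rewrite indic_levelE.
Qed.

Lemma measurable_level F s : measurable_fun (`[0, 1]%classic : set R) F ->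
  measurable (level F s).
Proof.
move=> mF; have [s0|s0] := leP 0 s; last first.
  rewrite (_ : level F s = set0)//; apply/seteqP; split => // v [_ + _].
  by rewrite leNgt s0.
rewrite (_ : level F s = [set v | s < `|restr F v|]); last first.
  apply/seteqP; split => v; first by move/mem_set; rewrite levelP s0.
  by move=> /= sF; apply: set_mem; rewrite levelP s0.
rewrite -[X in measurable X]setTI.
rewrite (_ : [set v | _] = (fun v => `|restr F v|) @^-1` `]s, +oo[%classic); last first.
  by apply/seteqP; split => v /=; rewrite in_itv/= andbT.
exact: (mrestr mF).
Qed.

Lemma lorentz_norm_evenrad n : (0 < n)%N -> exists2 K : R, 0 < K &
  forall (a1 a2 p : R) F, 0 < p -> measurable_fun (`[0, 1]%classic : set R) F ->
  (lorentz_norm a1 a2 p (@evenrad R n F) = p%:E * \int[mu]_s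
     (K%:E * \int[mu]_x (\1_(level F s) `|x|%R * profile n a1 a2 x)%:E) `^ p^-1)%E.
Proof.
move=> n0; have [K K0 KE] := @muS_evenrad R n n0; exists K => // a1 a2 p F p0 mF.
rewrite /lorentz_norm; congr (_ * _)%E.
rewrite integral_mkcond; apply: eq_integral => s _; rewrite patchE.
case: ifPn => [|sN]; last first.
  (* For [s < 0] the level set is empty, and [0] to the positive power [1/p] is [0]. *)
  rewrite integral0_eq ?mule0 ?poweR0r ?invr_eq0 ?gt_eqF// => x _.
  rewrite indic_levelE (_ : (0 <= s) = false) ?mul0r//.
  by apply/negbTE; move: sN; rewrite mem_setE in_itv/= andbT.
rewrite mem_setE in_itv/= andbT => s0.
have lE : level F s = [set v | s < `|F v|] `&` `[0, 1].
  apply/seteqP; split => v /=; first by case=> v01 _ sF; rewrite in_itv.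
  by rewrite in_itv/= => -[sF v01].
by rewrite lE -KE// -lE; exact: measurable_level.
Qed.

Lemma measurable_level_integral F (u f : R -> R) :
  measurable_fun (`[0, 1]%classic : set R) F -> measurable_fun setT u ->
  measurable_fun setT f -> (forall x, 0 <= f x) ->
  measurable_fun setT (fun s : R => \int[mu]_x (\1_(level F s) (u x) * f x)%:E)%E.
Proof.
move=> mF mu mf f0.
apply: (measurable_integral2 (g := fun s x => (\1_(level F s) (u x) * f x)%:E)); last first.
  by move=> s x; rewrite lee_fin mulr_ge0.
apply: (measurableT_comp (f := EFin)) => //; apply: measurable_funM; last first.
  by apply: (measurableT_comp mf); exact: measurable_snd.
apply: (measurableT_comp (measurable_indic_level mF) (g := fun z : R * R => (z.1, u z.2))).
apply: measurable_fun_pair; first exact: measurable_fst.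
by apply: (measurableT_comp mu); exact: measurable_snd.
Qed.

(** As [f] vanishes for [|x| >= 1], only the values of [F] on [[0, 1]] enter, where it agrees with
    its measurable extension by zero. *)
Lemma integral_level_layer_cake F (c : R) (f : R -> R) :
  measurable_fun (`[0, 1]%classic : set R) F -> 0 <= c -> c <= 1 ->
  measurable_fun setT f -> (forall x, 0 <= f x) -> (forall x, 1 <= x ^+ 2 -> f x = 0) ->
  (\int[mu]_x (`|F (c * `|x|)| * f x)%:E =
   \int[mu]_s \int[mu]_x (\1_(level F s) (c * `|x|)%R * f x)%:E)%E.
Proof.
move=> mF c0 c1 mf f0 f1.
have mcx : measurable_fun setT (fun x : R => c * `|x|) by apply: measurable_funM.
have mfE : measurable_fun setT (fun x => (f x)%:E) by exact: (measurableT_comp (f := EFin)).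
have mg : measurable_fun setT (fun x : R => (`|restr F (c * `|x|)|)%:E).
  by apply: (measurableT_comp (f := EFin)) => //; exact: (measurableT_comp (mrestr mF) mcx).
transitivity (\int[mu]_x ((`|restr F (c * `|x|)%R|)%:E * (f x)%:E))%E.
  apply: eq_integral => x _; rewrite -EFinM; congr EFin.
  have [x1|x1] := leP 1 (x ^+ 2); first by rewrite f1// !mulr0.
  have {}x1 : `|x| <= 1 by rewrite -(expr_le1 (n := 2))// real_normK ?num_real// ltW.
  by rewrite /restr patchE mem_set//= in_itv/= mulr_ge0//= mulr_ile1.
rewrite (ge0_integral_layer_cake mu mfE _ mg) => [|x|x]; [|by rewrite lee_fin|by rewrite lee_fin].
apply: eq_integral => s _; apply: eq_integral => x _.
by rewrite EFinM indic_levelE lte_fin; case: ifP.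
Qed.

End level_sets.

(** * Sufficiency of the conditions *)

Section sufficiency.
Context {R : realType}.
Notation mu := (@lebesgue_measure R).

Lemma lebI0 m : lebI (fun _ : m.-tuple R => 0%E) = 0%E.
Proof. by elim: m => [//|m IH] /=; under eq_integral do rewrite IH; rewrite integral0. Qed.

Lemma ae_mx_all m1 m2 (P : 'M[R]_(m1, m2) -> Prop) : (forall A, P A) -> ae_mx P.
Proof.
move=> PA; exists set0; split; first exact: measurable0.
split; first by move=> t /= /(_ (PA _)).
by rewrite (_ : (fun t => _) = fun=> 0%E) ?lebI0//; apply/funext => t; rewrite indic0.
Qed.

(** The layer cake formula needs a nonnegative function; this replaces [F] by [|F|] beforehand. *)
Lemma abse_Rk k n (A : 'M[R]_(k.+1, n.+1)) (F : R -> R) :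
  (`|Rk A (evenrad F)| <= Rk A (evenrad (fun v => `|F v|%R)))%E.
Proof.
rewrite /Rk abseM gee0_abs; last by rewrite lee_fin mulr_ge0// sqrtr_ge0.
apply: lee_wpmul2l; first by rewrite lee_fin mulr_ge0// sqrtr_ge0.
apply: le_trans (abse_lebI _) _; apply: le_lebI => t; first exact: abse_ge0.
by rewrite /=; case: ifP => // _; rewrite abse0.
Qed.

Lemma inXi_cos k n (A : 'M[R]_(k.+1, n.+1)) (c : R) : 0 <= c ->
  (forall y, `|(y *m A) 0 ord_max| <= c * enorm (y *m A)) ->
  (exists2 y, enorm (y *m A) = 1 & (y *m A) 0 ord_max = c) ->
  [/\ c <= 1, cos (dist0 A) = c, sin (dist0 A) = Num.sqrt (1 - c ^+ 2)
    & dist0 A < pi / 2 <-> 0 < c].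
Proof.
move=> c0 ub att; have [c1 dE] := dist0_max c0 ub att.
have c11 : -1 <= c <= 1 by rewrite c1 andbT; apply: le_trans c0; rewrite oppr_le0.
rewrite dE; split => //; [by rewrite acosK// in_itv|exact: sin_acos|].
split => [|cp].
  rewrite [0 < c]lt_def c0 andbT; apply: contraTneq => ->.
  by rewrite acos0 ltxx.
rewrite ltNge -acos0; apply/negP => h.
have z11 : -1 <= (0 : R) <= 1 by rewrite oppr_le0 !ler01.
have : cos (acos c) <= cos (acos 0).
  rewrite le_eqVlt; move: h; rewrite le_eqVlt => /orP[/eqP ->|h]; first by rewrite eqxx.
  by rewrite ltr_cos ?in_itv/= ?acos_ge0 ?acos_lepi// h orbT.
by rewrite !acosK ?in_itv//= leNgt cp.
Qed.

(** [key_inequality] is integrated over the levels of [F]. The bound is obtained for every plane in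
    the domain, not merely almost every one. *)
Lemma estimate_sufficient n k (a1 a2 g1 g2 : R) : (0 < n)%N -> (0 < k)%N -> 0 < a2 ->
  0 <= g1 -> (a1 + n%:R) / (1 + a2) - k%:R <= g1 -> 1 <= g2 -> 2 <= (1 + a2) * k%:R ->
  estimate n k a1 a2 g1 g2.
Proof.
move=> n0 k0 a20 g10 g1n g21 pk.
have [K1 K10 LE] := @lorentz_norm_evenrad R n n0.
have [K2 K20 RE] := @Rk_evenrad R k k0.
have [C C0 CE] := @key_inequality R n k a1 a2 g1 k0 a20 g10 g1n pk.
set p := 1 + a2; have p0 : 0 < p by rewrite /p; lra.
(* [K2] comes from the transform and [C] from [key_inequality]; the factors [p] and [K1^(1/p)]
   contained in the norm are divided out. *)
exists (K2 * C * (K1 `^ p^-1)^-1 / p) => F mF _.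
apply: ae_mx_all => A [Afree dlt].
have [c [c0 ub att RkE]] := RE _ _ Afree.
have [c1 -> -> /iffLR/(_ dlt) cpos] := inXi_cos c0 ub att.
set s := Num.sqrt (1 - c ^+ 2) `^ g1.
have s0 : 0 <= s by exact: powR_ge0.
have mF' : measurable_fun (`[0, 1]%classic : set R) (fun v => `|F v|) by exact: measurableT_comp.
have chi0 x : 1 <= x ^+ 2 -> chi_density k (1 - x ^+ 2) = 0 :> R.
  by move=> x1; rewrite /chi_density ltNge subr_le0 x1.
pose J t := (\int[mu]_x (\1_(level F t) `|x|%R * profile n a1 a2 x)%:E)%E.
have J0 t : (0 <= J t)%E by apply: integral_ge0 => x _; rewrite lee_fin mulr_ge0 ?profile_ge0.
have mJ : measurable_fun setT (fun t => (K1%:E * J t) `^ p^-1)%E.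
  apply: (measurableT_comp (measurable_poweR _)).
  apply: measurable_funeM; apply: (measurable_level_integral (u := fun x => `|x|)) => //.
    exact: measurable_profile.
  exact: profile_ge0.
rewrite abseM gee0_abs; last by rewrite lee_fin mulr_ge0 ?powR_ge0.
apply: (@le_trans _ _ ((s * c)%:E * (K2%:E * \int[mu]_x (`|F (c * `|x|)| * chi_density k (1 - x ^+ 2))%:E))%E).
  have RkF := RkE (fun v => `|F v|) mF' (fun v => normr_ge0 _).
  rewrite -RkF; apply: lee_pmul; rewrite ?lee_fin ?mulr_ge0 ?powR_ge0 ?abse_ge0//; last exact: abse_Rk.
  (* [1 <= g2] and [c <= 1] give [c^g2 <= c], the critical case. *)
  rewrite ler_wpM2l// -[leRHS](powRr1 c0) ger_powR// cpos c1//.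
rewrite (integral_level_layer_cake (f := fun x => chi_density k (1 - x ^+ 2))) => //; first last.
- by move=> x; exact: chi_density_ge0.
- by apply: (measurableT_comp (measurable_chi_density k)); measurable_real.
rewrite muleCA -ge0_integralZl_EFin; last (by rewrite mulr_ge0); first last.
- apply: measurable_level_integral => //; first exact: measurable_funM.
    by apply: (measurableT_comp (measurable_chi_density k)); measurable_real.
  by move=> x; exact: chi_density_ge0.
- by move=> t _; apply: integral_ge0 => x _; rewrite lee_fin mulr_ge0 ?chi_density_ge0.
- exact: measurableT.
rewrite LE//.
have Kp : 0 < K1 `^ p^-1 by exact: powR_gt0.
have -> : ((K2 * C * (K1 `^ p^-1)^-1 / p)%:E * (p%:E * \int[mu]_t (K1%:E * J t) `^ p^-1) =
    K2%:E * ((C / K1 `^ p^-1)%:E * \int[mu]_t (K1%:E * J t) `^ p^-1))%E.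
  rewrite !muleA -!EFinM; congr (_%:E * _)%E; rewrite mulrA; field.
  by rewrite !gt_eqF.
apply: lee_wpmul2l; first by rewrite lee_fin ltW.
rewrite -ge0_integralZl_EFin; last (by rewrite divr_ge0// ltW); first last.
- exact: mJ.
- by move=> t _; exact: poweR_ge0.
- exact: measurableT.
apply: le_integral_ge0 => t.
  rewrite mule_ge0 ?lee_fin ?mulr_ge0//.
  by apply: integral_ge0 => x _; rewrite lee_fin mulr_ge0 ?chi_density_ge0.
apply: le_trans (CE c (level F t) cpos c1 (measurable_level _ mF)) _.
by rewrite poweRM ?lee_fin ?(ltW K10)// poweR_EFin muleA -EFinM divfK ?gt_eqF//.
Qed.

End sufficiency.

(** * Necessity of the conditions *)

Section necessity.
Context {R : realType}.
Notation mu := (@lebesgue_measure R).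

(** If [t > s], then [A <= B d^(t-s)] fails as [d] tends to [0]. Every necessary condition is read
    off by such a comparison of exponents. *)
Lemma powR_exponent_le (A B s t d0 : R) : 0 < A -> 0 < d0 ->
  (forall d, 0 < d -> d < d0 -> A * d `^ s <= B * d `^ t) -> t <= s.
Proof.
move=> A0 d00 H; rewrite leNgt; apply/negP => st.
have e0 : 0 < t - s by rewrite subr_gt0.
have {}H d : 0 < d -> d < d0 -> A <= B * d `^ (t - s).
  move=> dp dd0; have := H d dp dd0.
  rewrite powRB; last by apply/implyP => _; rewrite gt_eqF.
  by rewrite mulrA ler_pdivlMr ?powR_gt0.
have d2 : 0 < d0 / 2 by rewrite divr_gt0.
have d3 : d0 / 2 < d0 by lra.
have B0 : 0 < B.
  by have := lt_le_trans A0 (H _ d2 d3); rewrite pmulr_lgt0// powR_gt0.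
pose r := A / (2 * B); have r0 : 0 < r by rewrite divr_gt0// mulr_gt0.
pose d := Num.min (d0 / 2) (r `^ (t - s)^-1).
have dp : 0 < d by rewrite lt_min d2 powR_gt0.
have dd0 : d < d0 by rewrite (le_lt_trans _ d3)// ge_min lexx.
have dr : d `^ (t - s) <= r.
  rewrite -[leRHS](powRr1 (ltW r0)) -(mulVf (lt0r_neq0 e0)) powRrM.
  by rewrite ge0_ler_powR ?nnegrE ?(ltW e0) ?(ltW dp) ?powR_ge0// ge_min lexx orbT.
have := le_trans (H d dp dd0) (ler_wpM2l (ltW B0) dr).
have -> : B * r = A / 2 by rewrite /r; field; rewrite gt_eqF.
by move=> h; lra.
Qed.

Lemma profileN n (a1 a2 x : R) : profile n a1 a2 `|x| = profile n a1 a2 x.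
Proof. by rewrite /profile real_normK ?num_real// normr_id. Qed.

Lemma profileE n (a1 a2 x : R) : 0 <= x -> x < 1 ->
  profile n a1 a2 x = (1 - x ^+ 2) `^ ((a1 + n%:R) / 2 - 1) * x `^ a2.
Proof.
move=> x0 x1; have q0 : 0 < 1 - x ^+ 2 by rewrite subr_gt0 expr_lt1.
rewrite /profile /chi_density q0 ger0_norm// -powR12_sqrt ?(ltW q0)// -powRrM mulrAC.
rewrite -powRD; last by apply/implyP => _; rewrite gt_eqF.
by congr (_ `^ _ * _); ring.
Qed.

Lemma powR_scaled_ub (l u d q b : R) : 0 < l -> 0 < u -> 0 < d ->
  l * d <= q -> q <= u * d -> q `^ b <= (l `^ b + u `^ b) * d `^ b.
Proof.
move=> l0 u0 d0 lq qu; rewrite mulrDl -!powRM ?(ltW l0) ?(ltW u0) ?(ltW d0)//.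
by apply: powR_ub => //; rewrite mulr_gt0.
Qed.

Lemma powR_scaled_lb (l u d q b : R) : 0 < l -> 0 < u -> 0 < d ->
  l * d <= q -> q <= u * d -> (l `^ (- b) + u `^ (- b))^-1 * d `^ b <= q `^ b.
Proof.
move=> l0 u0 d0 lq qu.
have -> : d `^ b = (d `^ (- b))^-1 by rewrite powRN invrK.
rewrite -invfM mulrDl -!powRM ?(ltW l0) ?(ltW u0) ?(ltW d0)//.
by apply: powR_lb => //; rewrite mulr_gt0.
Qed.

Lemma lb_cst_gt0 (l u b : R) : 0 < l -> 0 < (l `^ b + u `^ b)^-1.
Proof. by move=> l0; rewrite invr_gt0 ltr_pwDl ?powR_gt0 ?powR_ge0. Qed.

Lemma lb_cst_ge0 (l u b : R) : 0 <= (l `^ b + u `^ b)^-1.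
Proof. by rewrite invr_ge0 addr_ge0 ?powR_ge0. Qed.

(** Tests with the indicator of [[a, b]]. Since [c] is only known to lie in []c1, c2[], the window
    [[u, v]] must keep [c x] in [[a, b]] for all such [c]; [P] and [m] are the bounds for the two
    densities. *)
Lemma estimate_test n k (a1 a2 g1 g2 : R) : (0 < k)%N -> (k < n)%N -> 0 < a2 ->
  estimate n k a1 a2 g1 g2 -> exists2 C : R, 0 < C & forall a b c1 c2 P u v m : R,
  0 <= a -> a < b -> b <= 1 -> 0 <= c1 -> c1 < c2 -> c2 <= 1 ->
  0 <= P -> (forall x, a <= x <= b -> profile n a1 a2 x <= P) ->
  0 <= u -> u < v -> 0 <= m ->
  (forall c x, c1 < c < c2 -> u <= x <= v -> a <= c * x <= b) ->
  (forall x, u <= x <= v -> m <= chi_density k (1 - x ^+ 2)) ->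
  exists2 c, c1 < c < c2 &
    (1 - c ^+ 2) `^ (g1 / 2) * c `^ g2 * (m * (v - u)) <= C * (P * (b - a)) `^ (1 + a2)^-1.
Proof.
move=> k0 kn a20 [Ce est].
have n0 : (0 < n)%N by exact: leq_ltn_trans kn.
have [K1 K10 LE] := @lorentz_norm_evenrad R n n0.
have [K2 K20 RE] := @Rk_evenrad R k k0.
set p := 1 + a2; have p0 : 0 < p by rewrite /p; lra.
have pV : 0 <= p^-1 by rewrite invr_ge0 ltW.
(* The constant in [estimate] may be negative, hence [|Ce| + 1]; the [2] counts the intervals
   [[a, b]] and [[-b, -a]]. *)
exists ((`|Ce| + 1) * p * (K1 * 2) `^ p^-1 / K2).
  by rewrite divr_gt0// !mulr_gt0// ?powR_gt0 ?mulr_gt0// ltr_wpDl.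
move=> a b c1 c2 P u v m a0 ab b1 c10 c12 c21 P0 PP u0 uv m0 cx mchi.
pose F : R -> R := \1_(`[a, b]%classic).
have F0 x : 0 <= F x by [].
have mF : measurable_fun (`[0, 1]%classic : set R) F.
  by apply: measurable_funTS; exact: measurable_indic.
have JE s : (\int[mu]_x (\1_(level F s) `|x|%R * profile n a1 a2 x)%:E <=
    (if (0 <= s < 1)%R then 2 * (P * (b - a)) else 0)%:E)%E.
  case: ifPn => s01; last first.
    rewrite integral0_eq// => x _; rewrite indicE memNset ?mul0r// => -[_ s0].
    rewrite /F indicE normr_nat; move: s01; rewrite s0/= -leNgt => s1.
    by case: (_ \in _) => /=; rewrite ltNge ?s1 ?s0.
  have mi (x y : R) : measurable_fun setT (fun z => (P * \1_(`[x, y]%classic : set R) z)%:E).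
    by apply: (measurableT_comp (f := EFin)) => //; apply: measurable_funM.
  apply: (@le_trans _ _ (\int[mu]_x ((P * \1_(`[a, b]%classic : set R) x)%:E +
      (P * \1_(`[- b, - a]%classic : set R) x)%:E))%E).
    apply: le_integral_ge0 => x; first by rewrite lee_fin mulr_ge0 ?profile_ge0.
    rewrite -EFinD lee_fin -mulrDr indicE.
    case: (boolP (_ \in _)) => [/set_mem[_ _]|_]; last by rewrite mul0r mulr_ge0// addr_ge0.
    move=> sF; have xab : a <= `|x| <= b.
      case/andP: s01 => s0 _; move: sF; rewrite /F indicE mem_setE in_itv/=.
      by case: (a <= `|x| <= b) => //=; rewrite normr0 ltNge s0.
    rewrite mul1r -profileN; apply: le_trans (PP _ xab) _.
    rewrite ler_peMr// !indicE !mem_setE !in_itv/=.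
    case: (ger0P x) xab => [x0 ->|x0 xab]; first by rewrite lerDl.
    rewrite (_ : (- b <= x <= - a) = true) ?lerDr//.
    by rewrite lerNl lerNr andbC.
  rewrite ge0_integralD; first last.
  - exact: mi.
  - by move=> x _; rewrite lee_fin mulr_ge0.
  - exact: mi.
  - by move=> x _; rewrite lee_fin mulr_ge0.
  - exact: measurableT.
  have Ei (x y : R) : x < y ->
      (\int[mu]_z (P * \1_(`[x, y]%classic : set R) z)%:E = (P * (y - x))%:E)%E.
    move=> xy; under eq_integral do rewrite EFinM.
    rewrite ge0_integralZl_EFin//.
      by rewrite integral_indic//= setIT lebesgue_measure_itv/= lte_fin xy -EFinB -EFinM.
    by apply: (measurableT_comp (f := EFin)) => //; exact: measurable_indic.
  rewrite !Ei ?ltrN2// -EFinD lee_fin le_eqVlt; apply/orP; left; apply/eqP; ring.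
have Lub : (lorentz_norm a1 a2 p (@evenrad R n F) <=
    (p * ((K1 * 2) `^ p^-1 * (P * (b - a)) `^ p^-1))%:E)%E.
  have Pab : 0 <= P * (b - a) by rewrite mulr_ge0// subr_ge0 ltW.
  rewrite LE// EFinM; apply: lee_wpmul2l; first by rewrite lee_fin ltW.
  rewrite -powRM//; last by rewrite mulr_ge0// ltW.
  set c := powR _ _.
  apply: (@le_trans _ _ (\int[mu]_s (c%:E * (\1_(`[0, 1[%classic : set R) s)%:E))%E).
    apply: le_integral_ge0 => s; first exact: poweR_ge0.
    apply: (@le_trans _ _ ((K1%:E * (if (0 <= s < 1)%R then 2 * (P * (b - a)) else 0)%:E) `^ p^-1)%E).
      apply: le_poweR => //.
        apply: mule_ge0; first by rewrite lee_fin ltW.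
        by apply: integral_ge0 => x _; rewrite lee_fin mulr_ge0 ?profile_ge0.
      by apply: lee_wpmul2l; [rewrite lee_fin ltW|exact: JE].
    rewrite -EFinM poweR_EFin -EFinM lee_fin indicE mem_setE in_itv/=.
    case: ifP => _; last by rewrite mulr0 powR0 ?mulr0// invr_eq0 gt_eqF.
    by rewrite mulr1 /c -!mulrA.
  rewrite ge0_integralZl_EFin ?powR_ge0//; last first.
    by apply: (measurableT_comp (f := EFin)) => //; exact: measurable_indic.
  rewrite integral_indic//= setIT lebesgue_measure_itv/= lte_fin ltr01 sube0 mule1.
  exact: lexx.
have Lfin : (lorentz_norm a1 a2 (1 + a2) (@evenrad R n F) < +oo)%E.
  by apply: le_lt_trans Lub _; rewrite ltry.
have [A [Afree PA cA]] := exists_generic_plane kn c10 c12 c21 (est F mF Lfin).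
have [c [c0 ub att RkE]] := RE _ _ Afree.
have cc := cA c c0 ub att.
have cpos : 0 < c by case/andP: cc => + _; exact: le_lt_trans.
have [c1' cosE sinE dE] := inXi_cos c0 ub att.
exists c => //.
have := PA (conj Afree (dE.2 cpos)); rewrite cosE sinE RkE//.
have s0 : 0 <= 1 - c ^+ 2 by rewrite subr_ge0 expr_le1.
have -> : Num.sqrt (1 - c ^+ 2) `^ g1 = (1 - c ^+ 2) `^ (g1 / 2).
  by rewrite -powR12_sqrt// -powRrM; congr (_ `^ _); ring.
set w := _ * _; have w0 : 0 <= w by rewrite mulr_ge0 ?powR_ge0.
have I0 : (0 <= \int[mu]_x (F (c * `|x|)%R * chi_density k (1 - x ^+ 2))%:E)%E.
  by apply: integral_ge0 => x _; rewrite lee_fin mulr_ge0 ?chi_density_ge0.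
rewrite gee0_abs; last by rewrite !mule_ge0// lee_fin// ltW.
move=> H.
have Ilb : ((m * (v - u))%:E <= \int[mu]_x (F (c * `|x|)%R * chi_density k (1 - x ^+ 2))%:E)%E.
  apply: (@le_trans _ _ (\int[mu]_x (m%:E * (\1_(`[u, v]%classic : set R) x)%:E))%E).
    rewrite ge0_integralZl_EFin//; last first.
      by apply: (measurableT_comp (f := EFin)) => //; exact: measurable_indic.
    by rewrite integral_indic//= setIT lebesgue_measure_itv/= lte_fin uv -EFinB -EFinM.
  apply: le_integral_ge0 => x; first by rewrite mule_ge0 ?lee_fin.
  rewrite -EFinM lee_fin indicE mem_setE in_itv/=.
  case: (boolP (u <= x <= v)) => uxv; last by rewrite mulr0 mulr_ge0 ?chi_density_ge0.
  have x0 : 0 <= x by apply: le_trans u0 _; case/andP: uxv.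
  by rewrite mulr1 (ger0_norm x0) /F indicE mem_setE in_itv/= cx//= mul1r mchi.
have {}H : (w%:E * (K2%:E * (m * (v - u))%:E) <=
    (`|Ce| + 1)%:E * (p * ((K1 * 2) `^ p^-1 * (P * (b - a)) `^ p^-1))%:E)%E.
  apply: (@le_trans _ _ (w%:E * (K2%:E * \int[mu]_x (F (c * `|x|)%R * chi_density k (1 - x ^+ 2))%:E))%E).
    apply: lee_wpmul2l; first by rewrite lee_fin.
    by apply: lee_wpmul2l; first by rewrite lee_fin ltW.
  apply: le_trans H _.
  have L0 : (0 <= lorentz_norm a1 a2 (1 + a2) (@evenrad R n F))%E.
    rewrite LE//; apply: mule_ge0; first by rewrite lee_fin ltW.
    by apply: integral_ge0 => s _; exact: poweR_ge0.
  apply: (@le_trans _ _ ((`|Ce| + 1)%:E * lorentz_norm a1 a2 (1 + a2) (@evenrad R n F))%E).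
    apply: lee_wpmul2r => //; rewrite lee_fin.
    by apply: le_trans (ler_norm _) _; rewrite lerDl.
  by apply: lee_wpmul2l => //; rewrite lee_fin addr_ge0.
rewrite -!EFinM lee_fin in H.
have -> : (`|Ce| + 1) * p * (K1 * 2) `^ p^-1 / K2 * (P * (b - a)) `^ p^-1 =
  (`|Ce| + 1) * (p * ((K1 * 2) `^ p^-1 * (P * (b - a)) `^ p^-1)) / K2 by ring.
by rewrite ler_pdivlMr// -mulrA [_ * K2]mulrC.
Qed.

Section consequences.
Variables (n k : nat) (a1 a2 g1 g2 : R).
Hypotheses (k0 : (0 < k)%N) (kn : (k < n)%N) (a20 : 0 < a2).
Hypothesis est : estimate n k a1 a2 g1 g2.

Let p := 1 + a2.
Let p0 : 0 < p. Proof. by rewrite /p addr_gt0. Qed.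
Let be := (a1 + n%:R) / 2 - 1.

Let chi_lb (x : R) : 0 <= x <= 1 / 2 -> (3 / 4) `^ (k%:R / 2) <= chi_density k (1 - x ^+ 2).
Proof.
move=> /andP[x0 x1]; have q34 : 3 / 4 <= 1 - x ^+ 2 by nra.
have q1 : 1 - x ^+ 2 <= 1 by nra.
have q0 : 0 < 1 - x ^+ 2 by lra.
rewrite chi_densityE// ler_pdivlMr//.
have h : (3 / 4) `^ (k%:R / 2) <= (1 - x ^+ 2) `^ (k%:R / 2).
  by rewrite ge0_ler_powR ?divr_ge0// ?nnegrE ?(ltW q0)//; lra.
by apply: le_trans h; rewrite ler_piMr ?powR_ge0.
Qed.

Let profile_ub (l x : R) : 0 < l -> 0 <= x -> l <= 1 - x ^+ 2 ->
  profile n a1 a2 x <= (l `^ be + 1 `^ be) * x `^ a2.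
Proof.
move=> l0 x0 lx; have x1 : x < 1.
  by rewrite -(expr_lt1 (n := 2))// -subr_gt0; exact: lt_le_trans lx.
rewrite profileE// ler_wpM2r ?powR_ge0//; apply: powR_ub => //.
by rewrite lerBlDr lerDl sqr_ge0.
Qed.

(** Test with [[0, a]] and [c] of order [a]: on [x <= 1/2] the transform is of order at least one,
    so the left side is of order at least [a^g2], while the norm is at most of order
    [(a^a2 a)^(1/p) = a]. *)
Lemma necessary_g2 : 1 <= g2.
Proof.
have [C C0 H] := estimate_test k0 kn a20 est.
pose M := (3 / 4 : R) `^ be + 1 `^ be.
have M0 : 0 <= M by rewrite addr_ge0 ?powR_ge0.
pose A := ((3 / 4) `^ (- (g1 / 2)) + 1 `^ (- (g1 / 2)))^-1 *
  ((1 / 2) `^ (- g2) + 1 `^ (- g2))^-1 * ((3 / 4) `^ (k%:R / 2) * (1 / 2 - 0)).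
have h12 : 0 < 1 / 2 :> R by lra.
have h34 : 0 < 3 / 4 :> R by lra.
apply: (@powR_exponent_le A (C * M `^ p^-1) g2 1 (1 / 2)) => //.
  by rewrite !mulr_gt0// ?lb_cst_gt0 ?powR_gt0// subr0.
move=> a ap a12.
have [|||||||||||||c /andP[ca1 ca2] Hc] := H 0 a (a / 2) a (M * a `^ a2) 0 (1 / 2) ((3 / 4) `^ (k%:R / 2)); try lra.
- by rewrite mulr_ge0// powR_ge0.
- move=> x /andP[x0 xa].
  apply: (le_trans (profile_ub h34 x0 _)); first by nra.
  by rewrite ler_wpM2l// ge0_ler_powR ?(ltW a20)// nnegrE// ltW.
- exact: powR_ge0.
- by move=> c x /andP[ca1 ca2] /andP[x0 x1]; apply/andP; split; nra.
- by move=> x x01; apply: chi_lb.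
rewrite powRr1 ?(ltW ap)//.
have RHS : C * (M * a `^ a2 * (a - 0)) `^ p^-1 = C * M `^ p^-1 * a.
  rewrite subr0 -mulrA [a `^ a2 * a]mulrC.
  have -> : a * a `^ a2 = a `^ p.
    by rewrite -(mulr_powRB1 (ltW ap) p0); congr (_ * _ `^ _); rewrite /p; ring.
  by rewrite powRM ?powR_ge0// -powRrM divff ?gt_eqF// powRr1 ?(ltW ap)// mulrA.
rewrite -RHS; apply: le_trans Hc.
have c2 : 3 / 4 <= 1 - c ^+ 2 by nra.
have c21 : 1 - c ^+ 2 <= 1 by nra.
rewrite /A; set m := _ `^ _ * _; rewrite mulrAC; apply: ler_wpM2r.
  by rewrite mulr_ge0 ?powR_ge0// subr0 ltW.
rewrite -mulrA; apply: ler_pM; rewrite ?mulr_ge0 ?powR_ge0 ?lb_cst_ge0//.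
  exact: powR_lb.
by apply: powR_scaled_lb => //; lra.
Qed.

(** The interval [[1/4, 1/2]] stays fixed while [c] tends to [1]: the norm does not change, and the
    sine weight is of order [d^(g1/2)]. *)
Lemma necessary_g1_ge0 : 0 <= g1.
Proof.
have [C C0 H] := estimate_test k0 kn a20 est.
pose M := (3 / 4 : R) `^ be + 1 `^ be.
have M0 : 0 <= M by rewrite addr_ge0 ?powR_ge0.
have h12 : 0 < 1 / 2 :> R by lra.
have h34 : 0 < 3 / 4 :> R by lra.
pose A := ((1 / 2) `^ (- (g1 / 2)) + 2 `^ (- (g1 / 2)))^-1 *
  ((1 / 2) `^ (- g2) + 1 `^ (- g2))^-1 * ((3 / 4) `^ (k%:R / 2) * (1 / 2 - 1 / 3)).
suff : 0 <= g1 / 2 by lra.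
apply: (@powR_exponent_le A (C * (M * (1 / 2 - 1 / 4)) `^ p^-1) (g1 / 2) 0 (1 / 4)) => //; first last.
- move=> d dp d14.
  (* The window starts at [1/3] because [c > 3/4] then gives [c x >= 1/4]. *)
  have [|||||||||||||c /andP[cd1 cd2] Hc] := H (1 / 4) (1 / 2) (1 - d) (1 - d / 2) M (1 / 3) (1 / 2) ((3 / 4) `^ (k%:R / 2)); try lra.
  + move=> x /andP[x0 xa].
    apply: (le_trans (profile_ub h34 _ _)); [by lra|by nra|].
    rewrite ler_piMr// -[leRHS](powRr0 x) ger_powR ?(ltW a20)//; lra.
  + exact: powR_ge0.
  + by move=> c x /andP[ca1 ca2] /andP[x0 x1]; apply/andP; split; nra.
  + by move=> x /andP[x0 x01]; apply: chi_lb; lra.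
  rewrite powRr0 mulr1; apply: le_trans Hc.
  rewrite /A; set m := _ `^ _ * (_ - _); rewrite mulrAC; apply: ler_wpM2r.
    by rewrite mulr_ge0 ?powR_ge0//; lra.
  rewrite mulrAC; apply: ler_pM; rewrite ?mulr_ge0 ?powR_ge0 ?lb_cst_ge0//.
    by apply: powR_scaled_lb => //; nra.
  by apply: powR_lb => //; lra.
- by rewrite !mulr_gt0// ?lb_cst_gt0 ?powR_gt0//; lra.
Qed.

(** Everything takes place at distance of order [d] from [1]: the left side is at least of order
    [d^(g1/2) d^(k/2-1) d], the norm at most of order [(d^be d)^(1/p)], where
    [be + 1 = (a1+n)/2]. *)
Lemma necessary_g1 : (a1 + n%:R) / (1 + a2) - k%:R <= g1.
Proof.
have [C C0 H] := estimate_test k0 kn a20 est.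
have h12 : 0 < 1 / 2 :> R by lra.
have h14 : 0 < 1 / 4 :> R by lra.
pose M := (1 / 2 : R) `^ be + 4 `^ be.
have M0 : 0 <= M by rewrite addr_ge0 ?powR_ge0.
pose kb : R := k%:R / 2 - 1.
pose m := ((1 / 4 : R) `^ (- kb) + 1 `^ (- kb))^-1.
have m0 : 0 < m by exact: lb_cst_gt0.
pose A := ((1 / 2) `^ (- (g1 / 2)) + 2 `^ (- (g1 / 2)))^-1 *
  ((1 / 2) `^ (- g2) + 1 `^ (- g2))^-1 * (m / 4).
suff : (be + 1) / p <= g1 / 2 + k%:R / 2.
  have -> : (be + 1) / p = (a1 + n%:R) / (1 + a2) / 2.
    by rewrite /be /p; field; rewrite gt_eqF.
  by move=> h; lra.
apply: (@powR_exponent_le A (C * (M * (3 / 2)) `^ p^-1) _ _ (1 / 4)) => //.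
  by rewrite /A !mulr_gt0// ?lb_cst_gt0//; lra.
move=> d dp d14.
have [|||||||||||||c /andP[cd1 cd2] Hc] := H (1 - 2 * d) (1 - d / 2) (1 - d) (1 - d / 2)
  (M * d `^ be) (1 - d / 2) (1 - d / 4) (m * d `^ kb); try lra.
- by rewrite mulr_ge0// powR_ge0.
- move=> x /andP[x0 xa].
  have x00 : 0 <= x by lra.
  rewrite profileE//; last by lra.
  apply: (@le_trans _ _ ((1 - x ^+ 2) `^ be)).
    rewrite ler_piMr ?powR_ge0// -[leRHS](powRr0 x) ger_powR ?(ltW a20)//; lra.
  by apply: powR_scaled_ub => //; nra.
- by rewrite mulr_ge0 ?powR_ge0 ?(ltW m0).
- by move=> c x /andP[ca1 ca2] /andP[x0 x1]; apply/andP; split; nra.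
- move=> x /andP[x0 x01].
  have q1 : 1 / 4 * d <= 1 - x ^+ 2 by nra.
  rewrite /chi_density ifT; last by lra.
  by apply: powR_scaled_lb => //; nra.
have dE : d `^ (g1 / 2 + k%:R / 2) = d `^ (g1 / 2) * (d `^ kb * d).
  rewrite -[X in _ * (_ * X)](powRr1 (ltW dp)) -!powRD; try by apply/implyP => _; rewrite gt_eqF.
  by congr (_ `^ _); rewrite /kb; ring.
have RHS : C * (M * d `^ be * (1 - d / 2 - (1 - 2 * d))) `^ p^-1 =
    C * (M * (3 / 2)) `^ p^-1 * d `^ ((be + 1) / p).
  have -> : M * d `^ be * (1 - d / 2 - (1 - 2 * d)) = M * (3 / 2) * (d `^ be * d) by field.
  rewrite -[X in _ * (_ * X)](powRr1 (ltW dp)) -powRD; last by apply/implyP => _; rewrite gt_eqF.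
  by rewrite powRM ?powR_ge0 ?mulr_ge0// -powRrM mulrA.
rewrite -RHS dE; apply: le_trans Hc.
have -> : 1 - d / 4 - (1 - d / 2) = d / 4 by field.
have -> : A * (d `^ (g1 / 2) * (d `^ kb * d)) =
  ((1 / 2) `^ (- (g1 / 2)) + 2 `^ (- (g1 / 2)))^-1 * d `^ (g1 / 2) *
  ((1 / 2) `^ (- g2) + 1 `^ (- g2))^-1 * (m * d `^ kb * (d / 4)) by rewrite /A; ring.
apply: ler_wpM2r; first by rewrite !mulr_ge0 ?powR_ge0 ?(ltW m0)//; lra.
apply: ler_pM; rewrite ?mulr_ge0 ?powR_ge0 ?lb_cst_ge0//.
  by apply: powR_scaled_lb => //; nra.
by apply: powR_lb => //; lra.
Qed.

(** [c] stays near [1/2], and an interval of length [2 d] about [1/2] has norm at most of order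
    [d^(1/p)]. The points [x] at distance of order [d] from [1] have density of order [d^(-1/2)], so
    they contribute [d^(1/2)]. *)
Lemma necessary_p : k = 1%N -> 2 <= 1 + a2.
Proof.
move=> k1; have [C C0 H] := estimate_test k0 kn a20 est.
have h12 : 0 < 1 / 2 :> R by lra.
have h716 : 0 < 7 / 16 :> R by lra.
(* The test interval lies in [[1/4, 3/4]], and [7/16 = 1 - (3/4)^2]. *)
pose M := (7 / 16 : R) `^ be + 1 `^ be.
have M0 : 0 <= M by rewrite addr_ge0 ?powR_ge0.
pose kb : R := k%:R / 2 - 1.
have kbE : kb + 1 = 1 / 2 by rewrite /kb k1; field.
clear k1.
pose m := ((1 / 2 : R) `^ (- kb) + 2 `^ (- kb))^-1.
have m0 : 0 < m by exact: lb_cst_gt0.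
pose A := ((1 / 2) `^ (- (g1 / 2)) + 1 `^ (- (g1 / 2)))^-1 *
  ((1 / 2) `^ (- g2) + 1 `^ (- g2))^-1 * (m / 2).
suff : p^-1 <= 1 / 2.
  by rewrite -[p^-1]mul1r ler_pdivrMr// /p; lra.
apply: (@powR_exponent_le A (C * (M * 2) `^ p^-1) _ _ (1 / 4)) => //.
  by rewrite /A !mulr_gt0// ?lb_cst_gt0//; lra.
move=> d dp d14.
have [|||||||||||||c /andP[cd1 cd2] Hc] := H (1 / 2 - d) (1 / 2 + d) (1 / 2) (1 / 2 + d / 2)
  M (1 - d) (1 - d / 2) (m * d `^ kb); try lra.
- move=> x /andP[x0 xa].
  apply: (le_trans (profile_ub h716 _ _)); [by lra|by nra|].
  rewrite ler_piMr// -[leRHS](powRr0 x) ger_powR ?(ltW a20)//; lra.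
- by rewrite mulr_ge0 ?powR_ge0 ?(ltW m0).
- by move=> c x /andP[ca1 ca2] /andP[x0 x1]; apply/andP; split; nra.
- move=> x /andP[x0 x01].
  have q1 : 1 / 2 * d <= 1 - x ^+ 2 by nra.
  rewrite /chi_density ifT; last by lra.
  by apply: powR_scaled_lb => //; nra.
have dE : d `^ (1 / 2) = d `^ kb * d.
  rewrite -kbE powRD ?powRr1 ?(ltW dp)//.
  by apply/implyP => _; rewrite gt_eqF.
have RHS : C * (M * (1 / 2 + d - (1 / 2 - d))) `^ p^-1 = C * (M * 2) `^ p^-1 * d `^ p^-1.
  have -> : M * (1 / 2 + d - (1 / 2 - d)) = M * 2 * d by field.
  by rewrite powRM ?(ltW dp) ?mulr_ge0// mulrA.
rewrite -RHS dE; apply: le_trans Hc.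
have -> : 1 - d / 2 - (1 - d) = d / 2 by field.
have -> : A * (d `^ kb * d) =
  ((1 / 2) `^ (- (g1 / 2)) + 1 `^ (- (g1 / 2)))^-1 *
  ((1 / 2) `^ (- g2) + 1 `^ (- g2))^-1 * (m * d `^ kb * (d / 2)) by rewrite /A; ring.
apply: ler_wpM2r; first by rewrite !mulr_ge0 ?powR_ge0 ?(ltW m0)//; lra.
apply: ler_pM; rewrite ?mulr_ge0 ?powR_ge0 ?lb_cst_ge0//.
  by apply: powR_lb => //; nra.
by apply: powR_lb => //; lra.
Qed.

End consequences.
End necessity.

Theorem theorem5p11 (R : realType) (n k : nat) (a1 a2 g1 g2 : R) :
  (2 <= n)%N -> (1 <= k <= n.-1)%N -> 0 < a2 ->
  ((2 <= k)%N ->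
     (estimate n k a1 a2 g1 g2 <->
      Num.max 0 ((a1 + n%:R) / (1 + a2) - k%:R) <= g1 /\ 1 <= g2)) /\
  (k = 1%N ->
     (estimate n k a1 a2 g1 g2 <->
      [/\ Num.max 0 ((a1 + n%:R) / (1 + a2) - k%:R) <= g1, 1 <= g2
        & 2 <= 1 + a2])).
Proof.
move=> n2 /andP[k1 kn1] a20.
have n0 : (0 < n)%N by exact: leq_trans n2.
have kn : (k < n)%N by rewrite -(prednK n0) ltnS.
have nec : estimate n k a1 a2 g1 g2 ->
    Num.max 0 ((a1 + n%:R) / (1 + a2) - k%:R) <= g1 /\ 1 <= g2.
  move=> est; rewrite ge_max (necessary_g1_ge0 k1 kn a20 est) (necessary_g1 k1 kn a20 est).
  by split => //; exact: necessary_g2 est.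
split => [k2|kE]; split.
- exact: nec.
- rewrite ge_max => -[/andP[h1 h2] h3]; apply: estimate_sufficient => //.
  (* For [k >= 2] the requirement [2 <= (1 + a2) k] follows from [a2 > 0]; for [k = 1] it is the
     condition [p >= 2]. *)
  have : (2%:R : R) <= k%:R by rewrite ler_nat.
  by move=> h; nra.
- by move=> est; have [h1 h2] := nec est; split => //; exact: necessary_p est kE.
- by rewrite ge_max => -[/andP[h1 h2] h3 h4]; apply: estimate_sufficient => //; rewrite kE mulr1.
Qed.
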